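(* Consider the G-Latent model with $n$ i.i.d. samples, and let $\mathbf D=\hat{\boldsymbol\Gamma}-\hat{\boldsymbol\Sigma}$, where $\hat{\boldsymbol\Gamma}$ satisfies the estimator assumption below. Assume $\log d\le p_0 n$. There exist constants $c_1,c_2,c_3>0$ (not depending on $n,d,K,m,\mathbf C^*,\boldsymbol\Gamma^*$) such that if \[ \Delta(\mathbf C^* )\ \ge\ c_1\|\boldsymbol\Gamma^*\|_\infty\Big(\sqrt{\tfrac{\log d}{nm}}+\sqrt{\tfrac{d}{nm^2}}+\tfrac{d}{nm}\Big)+c_2\,\sigma\sqrt{\tfrac{\log d}{n}},\qquad \sigma=\max_i C^*_{ii}+\|\boldsymbol\Gamma^*\|_\infty, \] then with probability at least $1-c_3/d$ the FORCE dual certificate exists at $G^*$, i.e. there is $y_T\ge 0$ such that $\mathbf Q_i(\mathbf D,y_T)\succeq 0$ for every $i\in[K]$ and $y'_{ab}(\mathbf D,y_T)\ge 0$ for all $a,b$ lying in different clusters of $G^*$.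
   Context: G-Latent model: $G^*=\{G^*_1,\dots,G^*_K\}$ is a partition of $[d]$ with $m:=\min_k|G^*_k|\ge 3$; $\mathbf A\in\{0,1\}^{d\times K}$ with $A_{jk}=\mathbb 1\{j\in G^*_k\}$; $\mathbf X=\mathbf A\mathbf Z+\mathbf E$ where $\mathbf Z\sim\mathcal N(0,\mathbf C^* )$ in $\mathbb R^K$ and $\mathbf E\sim\mathcal N(0,\boldsymbol\Gamma^* )$ in $\mathbb R^d$ are independent and $\boldsymbol\Gamma^*$ is diagonal with entries $\gamma^*_j$. We observe $n$ i.i.d. copies $\mathbf X^1,\dots,\mathbf X^n$ and set $\hat{\boldsymbol\Sigma}=\frac1n\sum_{l=1}^n\mathbf X^l\mathbf X^{lT}$. $\|\cdot\|_\infty$ is the matrix $\ell_\infty$ norm (for a diagonal matrix, its largest absolute diagonal entry). $\Delta(\mathbf C^* ):=\min_{j<k}\mathbb E(Z_j-Z_k)^2=\min_{j<k}(C^*_{jj}+C^*_{kk}-2C^*_{jk})>0$. Estimator assumption: $\hat{\boldsymbol\Gamma}$ is a diagonal estimator of $\boldsymbol\Gamma^*$ for which there are constants $p_0,p_1,p_2$ such that whenever $\log d\le p_0 n$, with probability at least $1-p_2/d^3$, $\|\hat{\boldsymbol\Gamma}-\boldsymbol\Gamma^*\|_\infty\le p_1\|\boldsymbol\Gamma^*\|_\infty\sqrt{\log d/n}$. Certificate quantities: for a symmetric $d\times d$ matrix $\mathbf D$, $y_T\in\mathbb R$ and each $i$, write $\mathbf D_i=\mathbf D_{G^*_i,G^*_i}$,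 $n_i=|G^*_i|$, and define $\mathbf y_{G^*_i}(\mathbf D,y_T)=\mathbf L_i^{-1}(-\mathbf D_i\mathbf 1-y_T\mathbf 1)$ with $\mathbf L_i=n_i\mathbf I+\mathbf 1\mathbf 1^T$; equivalently, for $a\in G^*_i$, $y_a=\frac{1}{2n_i^2}\mathbf 1^T\mathbf D_i\mathbf 1-\frac1{n_i}\sum_{b\in G^*_i}D_{ab}-\frac{y_T}{2n_i}$. Define the $n_i\times n_i$ matrix $\mathbf Q_i(\mathbf D,y_T)=\mathbf D_i+\mathbf y_{G^*_i}\mathbf 1^T+\mathbf 1\mathbf y_{G^*_i}^T+y_T\mathbf I$, and for $a,b$ in different clusters $y'_{ab}(\mathbf D,y_T)=D_{ab}+y_a+y_b$. *)

(* Defs.v *)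
From HB Require Import structures.
From mathcomp Require Import all_boot all_order all_algebra.
From mathcomp Require Import all_classical all_reals all_analysis.
From mathcomp Require Import normal_distribution.

Set Implicit Arguments.
Unset Strict Implicit.
Unset Printing Implicit Defensive.

Import Order.TTheory GRing.Theory Num.Theory.
Local Open Scope classical_set_scope.
Local Open Scope ring_scope.

(* Mutual independence of a finite family of real random variables:
   the product rule for every family of measurable sets (taking B i = setT
   for unused indices gives every finite subfamily). *)
Definition mutually_independent {dT : measure_display} {T : measurableType dT}
  {R : realType} (P : probability T R) (I : finType) (X : I -> T -> R) : Prop :=
  forall B : I -> set R, (forall i, measurable (B i)) ->
    P (\bigcap_(i in [set: I]) (X i @^-1` B i)) =
    (\prod_(i : I) P (X i @^-1` B i))%E.

Definition std_normal_rv {dT : measure_display} {T : measurableType dT}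
  {R : realType} (P : probability T R) (X : T -> R) : Prop :=
  measurable_fun setT X /\
  forall B : set R, measurable B -> P (X @^-1` B) = normal_prob 0 1 B.

(* Partition G* of [d] into K clusters, given by a labelling lab. *)
Definition clsize (d K : nat) (lab : 'I_d -> 'I_K) (k : 'I_K) : nat :=
  #|[set j | lab j == k]|.

Definition minclsize (d K : nat) (lab : 'I_d -> 'I_K) : nat :=
  \big[minn/d]_(k : 'I_K) clsize lab k.

(* ||Gamma*||_inf for a (nonnegative) diagonal, given by its diagonal *)
Definition gmax {R : realType} (d : nat) (gamma : 'I_d -> R) : R :=
  \big[Num.max/0]_(j : 'I_d) `|gamma j|.

Definition ycert {R : realType} (d K : nat) (lab : 'I_d -> 'I_K)
  (D : 'M[R]_d) (yT : R) (a : 'I_d) : R :=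
  let ni : R := (clsize lab (lab a))%:R in
  (\sum_(b : 'I_d | lab b == lab a) \sum_(c : 'I_d | lab c == lab a) D b c)
     / (2 * ni ^+ 2)
  - (\sum_(b : 'I_d | lab b == lab a) D a b) / ni
  - yT / (2 * ni).

Definition Qcert {R : realType} (d K : nat) (lab : 'I_d -> 'I_K)
  (D : 'M[R]_d) (yT : R) (a b : 'I_d) : R :=
  D a b + ycert lab D yT a + ycert lab D yT b + (if a == b then yT else 0).

Definition ypcert {R : realType} (d K : nat) (lab : 'I_d -> 'I_K)
  (D : 'M[R]_d) (yT : R) (a b : 'I_d) : R :=
  D a b + ycert lab D yT a + ycert lab D yT b.

Definition Q_psd {R : realType} (d K : nat) (lab : 'I_d -> 'I_K)
  (D : 'M[R]_d) (yT : R) (i : 'I_K) : Prop :=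
  forall u : 'I_d -> R,
    0 <= \sum_(a : 'I_d | lab a == i) \sum_(b : 'I_d | lab b == i)
           u a * Qcert lab D yT a b * u b.

Definition certificate_exists {R : realType} (d K : nat) (lab : 'I_d -> 'I_K)
  (D : 'M[R]_d) : Prop :=
  exists yT : R, 0 <= yT /\
    (forall i : 'I_K, Q_psd lab D yT i) /\
    (forall a b : 'I_d, lab a != lab b -> 0 <= ypcert lab D yT a b).

(* Data of the G-Latent model: X^l = A Z^l + E^l, with
   Z^l = L xi^l_{1..K} (so Z^l ~ N(0, L L^T)) and
   E^l_j = sqrt(gamma_j) xi^l_{K+j}, xi i.i.d. N(0,1). *)
Definition Zlat {R : realType} {T : Type} (n d K : nat) (L : 'M[R]_K)
  (xi : 'I_n -> 'I_(K + d) -> T -> R) (l : 'I_n) (k : 'I_K) (w : T) : R :=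
  \sum_(r : 'I_K) L k r * xi l (lshift d r) w.

Definition Xdata {R : realType} {T : Type} (n d K : nat) (lab : 'I_d -> 'I_K)
  (L : 'M[R]_K) (gamma : 'I_d -> R) (xi : 'I_n -> 'I_(K + d) -> T -> R)
  (w : T) : 'M[R]_(n, d) :=
  \matrix_(l < n, j < d)
     (Zlat L xi l (lab j) w + Num.sqrt (gamma j) * xi l (rshift K j) w).

Definition Sigmahat {R : realType} (n d : nat) (X : 'M[R]_(n, d)) : 'M[R]_d :=
  \matrix_(a < d, b < d) ((n%:R)^-1 * \sum_(l < n) X l a * X l b).

(* Main.v *)
Require Import Defs.
From HB Require Import structures.
From mathcomp Require Import all_boot all_order all_algebra.
From mathcomp Require Import all_classical all_reals all_analysis.
From mathcomp Require Import normal_distribution measurable_realfun.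
From mathcomp Require Import measurable_fun_approximation simple_functions.
From mathcomp Require Import ring lra.

Set Implicit Arguments.
Unset Strict Implicit.
Unset Printing Implicit Defensive.

Import Order.TTheory GRing.Theory Num.Theory.
Import numFieldNormedType.Exports.
Local Open Scope classical_set_scope.
Local Open Scope ring_scope.

(** Since [Q_i] is the compression of [D_i + yT I] to the orthogonal complement
    of the constant vectors, the latent variables drop out of it, and [Q_i] is
    positive as soon as [yT] exceeds the largest eigenvalue of the noise part
    [1/n sum_l E^l E^lT - Gamma] plus the error of [Gamma-hat].  A lattice net
    bounds that eigenvalue by a constant times [g (sqrt (d / n) + d / n)].  On
    the other hand [y'_ab] is, up to diagonal terms and [yT / m],
      [1/(2n) sum_l ((X_a - X_b)^2 - (X_a - mean_j)^2 - (X_b - mean_k)^2)],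
    whose expectation combines with the diagonal terms to exactly [Delta_jk / 2]
    and whose fluctuations are of order [sigma sqrt (log d / n)].  Both estimates
    reduce to chi-square tails for linear forms of the Gaussian data, obtained
    from their joint moment generating function only. *)

(** * Integrals against densities and Gaussian integrals *)

(** Independence is given as a product rule for events and normality as a law on measurable sets.
    Both are converted once into the identity [E exp (sum t_l y_l) = exp (sum t_l ^ 2 / 2)], from
    which the two chi-square tails follow. The lower tail is the harder one: exp (- a y ^ 2) is not
    an average of real exponentials of linear forms, so a pointwise majorant replaces it.
    Fluctuations are controlled at two levels. Level 3 log d serves the at most d ^ 2 + d linear
    forms entering y'; with log d <= p0 n it yields the rate sigma sqrt (log d / n). Level 28 d
    serves the at most 2 ^ (27 d) net points; it fixes a deterministic [yT], and yT / m has order g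
    (sqrt (d / (n m ^ 2)) + d / (n m)). *)

Section density.
Local Open Scope ereal_scope.
Context d1 d2 (T1 : measurableType d1) (T2 : measurableType d2) (R : realType).
Variables (mu : {measure set T1 -> \bar R}) (nu : {measure set T2 -> \bar R}).
Variables (phi : T1 -> T2) (g : T1 -> R).
Hypotheses (mphi : measurable_fun setT phi) (mg : measurable_fun setT g).
Hypothesis g0 : forall x, (0 <= g x)%R.
Hypothesis nuE :
  forall B, measurable B -> nu B = \int[mu]_(x in phi @^-1` B) (g x)%:E.

Import HBNNSimple.

Let mpre B : measurable B -> measurable (phi @^-1` B).
Proof. by move=> mB; rewrite -[X in measurable X]setTI; exact: mphi. Qed.

Let mgE : measurable_fun setT (EFin \o g).
Proof. exact/measurable_EFinP. Qed.

Let integral_density_nnsfun (h : {nnsfun T2 >-> R}) :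
  \int[nu]_y (h y)%:E = \int[mu]_x ((h (phi x))%:E * (g x)%:E).
Proof.
under eq_integral do rewrite fimfunE -fsumEFin//.
rewrite ge0_integral_fsum//; last 2 first.
  - by move=> r; exact/measurable_EFinP/measurableT_comp.
  - by move=> n x _; rewrite EFinM nnfun_muleindic_ge0.
under [RHS]eq_integral.
  move=> x _; rewrite fimfunE -fsumEFin// ge0_mule_fsuml; last first.
    by move=> r; rewrite EFinM nnfun_muleindic_ge0.
  over.
rewrite [RHS]ge0_integral_fsum//; last 2 first.
  - move=> r; apply: emeasurable_funM => //.
    by apply/measurable_EFinP/measurable_funM => //; apply: measurableT_comp.
  - move=> n x _; rewrite EFinM; apply: mule_ge0; last by rewrite lee_fin.
    exact: nnfun_muleindic_ge0.
apply: eq_fsbigr => r; rewrite inE => -[y _ <-].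
rewrite integralZl_indic_nnsfun// integral_indic// setIT.
under [RHS]eq_integral do rewrite EFinM -muleA.
rewrite ge0_integralZl//; last 3 first.
- apply: emeasurable_funM => //.
  by apply/measurable_EFinP; apply: measurableT_comp.
- by move=> x _; rewrite mule_ge0// lee_fin.
- by rewrite lee_fin.
congr (_ * _); rewrite nuE//.
rewrite integral_mkcond; apply: eq_integral => x _.
rewrite /patch indicE.
have -> : (phi x \in h @^-1` [set h y]) = (x \in phi @^-1` (h @^-1` [set h y])) by [].
by case: ifP; rewrite ?mul1e ?mul0e.
Qed.

(** [nu] is the image under [phi] of the measure with density [g]. Keeping both covers normal
    densities ([phi] the identity), laws of random variables ([g = 1]) and the reweighted law in the
    independence argument. Monotone convergence extends the case of simple functions. *)
Lemma ge0_integral_density_pushforward (f : T2 -> R) :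
  measurable_fun setT f -> (forall y, (0 <= f y)%R) ->
  \int[nu]_y (f y)%:E = \int[mu]_x (f (phi x) * g x)%:E.
Proof.
move=> mf f0.
have mEf : measurable_fun setT (EFin \o f) by exact/measurable_EFinP.
pose f_ := nnsfun_approx measurableT mEf.
have cf y : EFin \o f_ ^~ y @ \oo --> (f y)%:E.
  by apply: (@cvg_nnsfun_approx _ _ _ _ measurableT _ mEf) => // z _; rewrite lee_fin.
transitivity (limn (fun n => \int[nu]_y (f_ n y)%:E)).
  rewrite -monotone_convergence//=.
  - by apply: eq_integral => x _; apply/esym/cvg_lim => //; exact: cf.
  - by move=> n; exact/measurable_EFinP.
  - by move=> n x _; rewrite lee_fin.
  - by move=> x _ a b ab; rewrite lee_fin//; exact/lefP/nd_nnsfun_approx.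
rewrite [X in limn X](_ : _ = (fun n => \int[mu]_x ((f_ n (phi x))%:E * (g x)%:E))); last first.
  by apply/funext => n; exact: integral_density_nnsfun.
rewrite -monotone_convergence//=.
- apply: eq_integral => x _; apply/cvg_lim => //.
  by rewrite EFinM; apply: cvgeZr => //; exact: cf.
- move=> n; apply: emeasurable_funM => //.
  by apply/measurable_EFinP; apply: measurableT_comp.
- by move=> n x _; rewrite mule_ge0 ?lee_fin.
- move=> x _ a b ab; rewrite lee_wpmul2r ?lee_fin//; exact/lefP/nd_nnsfun_approx.
Qed.

End density.

Section gaussian_integrals.
Local Open Scope ereal_scope.
Context {R : realType}.

Lemma ge0_integral_normal_prob (m s : R) (f : R -> R) :
  measurable_fun setT f -> (forall y, (0 <= f y)%R) ->
  \int[normal_prob m s]_y (f y)%:E =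
  \int[lebesgue_measure]_y (f y * normal_pdf m s y)%:E.
Proof.
move=> mf f0.
rewrite (ge0_integral_density_pushforward (mu := lebesgue_measure)
  (phi := idfun) (g := normal_pdf m s))//.
- exact: measurable_id.
- exact: measurable_normal_pdf.
- exact: normal_pdf_ge0.
Qed.

(** Completing the square: exp (t x) tilts the N(0, 1) density into exp (t ^ 2 / 2) times the N(t,
    1) density. *)
Lemma normal_mgf (t : R) :
  \int[normal_prob 0%R 1%R]_x (expR (t * x))%:E = (expR (t ^+ 2 / 2))%:E.
Proof.
rewrite ge0_integral_normal_prob//; last first.
  by apply: measurableT_comp => //; exact: measurable_funM.
transitivity (\int[lebesgue_measure]_y ((expR (t ^+ 2 / 2))%:E * (normal_pdf t 1 y)%:E)).
  apply: eq_integral => x _; rewrite -EFinM; congr EFin.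
  rewrite /normal_pdf oner_eq0 !(mulrCA _ (normal_peak _)); congr (_ * _)%R.
  rewrite /normal_fun -!expRD; congr expR.
  by field.
rewrite ge0_integralZl//.
- by rewrite integral_normal_pdf mule1.
- by apply/measurable_EFinP; exact: measurable_normal_pdf.
- by move=> x _; rewrite lee_fin normal_pdf_ge0.
Qed.

(** Tilting by exp (a x ^ 2) gives [s] times the centred normal density of variance
    [s ^ 2 = (1 - 2 a)^-1]. *)
Lemma normal_square_mgf (a : R) : (a < 1 / 2)%R ->
  \int[normal_prob 0%R 1%R]_x (expR (a * x ^+ 2))%:E =
    ((Num.sqrt (1 - 2 * a))^-1)%:E.
Proof.
move=> a1; have b0 : (0 < 1 - 2 * a)%R by lra.
set s := ((Num.sqrt (1 - 2 * a))^-1)%R.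
have s0 : (0 < s)%R by rewrite invr_gt0 sqrtr_gt0.
have s2 : (s ^+ 2 = (1 - 2 * a)^-1)%R by rewrite exprVn sqr_sqrtr// ltW.
rewrite ge0_integral_normal_prob//; last first.
  by apply: measurableT_comp => //; apply: measurable_funM.
transitivity (\int[lebesgue_measure]_y (s%:E * (normal_pdf 0 s y)%:E)).
  apply: eq_integral => x _; rewrite -EFinM; congr EFin.
  rewrite /normal_pdf oner_eq0 gt_eqF//.
  have peakE (u : R) : (0 < u)%R ->
      (normal_peak u = u^-1 * (Num.sqrt (pi *+ 2))^-1)%R.
    move=> u0; rewrite /normal_peak -mulrnAr sqrtrM ?sqr_ge0// sqrtr_sqr.
    by rewrite (gtr0_norm u0) invfM.
  rewrite !peakE// invr1 mul1r.
  rewrite -[in RHS]mulrA mulVKf ?gt_eqF// [LHS]mulrCA; congr (_ * _)%R.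
  rewrite /normal_fun -!expRD; congr expR.
  by rewrite s2; field; rewrite gt_eqF.
rewrite ge0_integralZl//.
- by rewrite integral_normal_pdf mule1.
- by apply/measurable_EFinP; exact: measurable_normal_pdf.
- by move=> x _; rewrite lee_fin normal_pdf_ge0.
- by rewrite lee_fin ltW.
Qed.

End gaussian_integrals.

(** * Products of independent variables *)

Section independence.
Local Open Scope ereal_scope.
Context d (T : measurableType d) (R : realType) (P : probability T R).

Lemma std_normal_rv_integral (X : T -> R) (f : R -> R) :
  std_normal_rv P X -> measurable_fun setT f -> (forall y, (0 <= f y)%R) ->
  \int[P]_x (f (X x))%:E = \int[normal_prob 0%R 1%R]_y (f y)%:E.
Proof.
move=> [mX PX] mf f0.
rewrite [RHS](ge0_integral_density_pushforward (nu := normal_prob 0%R 1%R) (mu := P)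
  (phi := X) (g := cst 1%R))//.
- by under [RHS]eq_integral do rewrite mulr1.
- move=> B mB; have mXB : measurable (X @^-1` B).
    by rewrite -[X in measurable X]setTI; exact: mX.
  rewrite (_ : (fun x => _) = cst 1)// integral_cst// mul1e; exact/esym/PX.
Qed.

Lemma std_normal_rv_mgf (X : T -> R) (t : R) : std_normal_rv P X ->
  \int[P]_x (expR (t * X x))%:E = (expR (t ^+ 2 / 2))%:E.
Proof.
move=> nX; rewrite -normal_mgf.
rewrite (std_normal_rv_integral (f := fun y => expR (t * y))%R)//.
by apply: measurableT_comp => //; exact: measurable_funM.
Qed.

(** The product rule is the case where every factor is an indicator. Indicators are replaced by
    nonnegative functions one index at a time, the list [s] holding the indices already freed. *)
Lemma mutually_independent_expectation_prod (I : finType) (X : I -> T -> R)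
    (h : I -> R -> R) (e : I -> R) :
  (forall i, measurable_fun setT (X i)) -> mutually_independent P X ->
  (forall i, measurable_fun setT (h i)) -> (forall i y, (0 <= h i y)%R) ->
  (forall i, \int[P]_x (h i (X i x))%:E = (e i)%:E) ->
  \int[P]_x (\prod_i h i (X i x))%:E = (\prod_i e i)%:E.
Proof.
move=> mX indX.
have mpre i B : measurable B -> measurable (X i @^-1` B).
  by move=> mB; rewrite -[X in measurable X]setTI; exact: mX.
suff H (s : seq I) : forall (h : I -> R -> R) (e : I -> R),
    (forall i, i \notin s -> exists2 B, measurable B & h i = \1_B) ->
    (forall i, measurable_fun setT (h i)) -> (forall i y, (0 <= h i y)%R) ->
    (forall i, \int[P]_x (h i (X i x))%:E = (e i)%:E) ->
    \int[P]_x (\prod_i h i (X i x))%:E = (\prod_i e i)%:E.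
  by apply: (H (enum I)) => i; rewrite mem_enum.
elim: s => {h e} [|j s IHs] h e hs mh h0 he.
  have /choice[B hB] i : exists B, measurable B /\ h i = \1_B.
    by have [B] := hs i isT; exists B.
  have -> : \int[P]_x (\prod_i h i (X i x))%:E =
      \int[P]_x (\1_(\bigcap_(i in [set: I]) (X i @^-1` B i)) x)%:E.
    apply: eq_integral => x _; congr EFin; rewrite indicE.
    have [|] := boolP (x \in _).
      rewrite inE => xB; rewrite big1// => i _; rewrite (hB i).2 indicE mem_set//.
      exact: xB.
    rewrite notin_setE => xB.
    have [i xBi] : exists i, ~ B i (X i x).
      apply: contrapT => /forallNP nB; apply: xB => i _; exact: (contrapT (nB i)).
    by rewrite (bigD1 i)//= (hB i).2 indicE memNset// mul0r.
  rewrite integral_indic//; last first.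
    apply: fin_bigcap_measurable => // i _; apply: mpre; exact: (hB i).1.
  rewrite setIT [LHS](indX B); last by move=> i; exact: (hB i).1.
  rewrite -prodEFin; apply: eq_bigr => i _; rewrite -he (hB i).2.
  transitivity (\int[P]_x (\1_(X i @^-1` B i) x)%:E); last exact: eq_integral.
  by rewrite integral_indic ?setIT//; apply: mpre; exact: (hB i).1.
have e0 i : (0 <= e i)%R.
  by rewrite -lee_fin -he; apply: integral_ge0 => x _; rewrite lee_fin.
have c0 : (0 <= \prod_(i | i != j) e i)%R by exact: prodr_ge0.
pose c := NngNum c0.
have mg (J : pred I) : measurable_fun setT (fun x => \prod_(i | J i) h i (X i x))%R.
  under eq_fun do rewrite big_mkcond; apply: measurable_prod => i _.
  by case: (J i) => //; exact: measurableT_comp.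
under eq_integral do rewrite (bigD1 j)//=.
(* The measure B |-> E [1_B (X_j) prod_(i != j) h_i (X_i)] is [c] times the law of [X j] by the
   induction hypothesis, so the integral of [h j] factorizes. *)
rewrite -(ge0_integral_density_pushforward (nu := mscale c (pushforward P (X j))))//.
- rewrite ge0_integral_mscale//; last 2 first.
    by apply/measurable_EFinP.
    by move=> y _; rewrite lee_fin.
  rewrite ge0_integral_pushforward//; last 2 first.
    by apply/measurable_EFinP.
    by move=> y _; rewrite lee_fin.
  rewrite preimage_setT /= he -EFinM; congr EFin.
  by rewrite mulrC [RHS](bigD1 j).
- by move=> x; apply: prodr_ge0.
- move=> B mB; rewrite /mscale/= /pushforward.
  pose h' i := if i == j then \1_B : R -> R else h i.
  pose e' i := if i == j then fine (P (X j @^-1` B)) else e i.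
  have h'j : h' j = \1_B by rewrite /h' eqxx.
  have e'j : e' j = fine (P (X j @^-1` B)) by rewrite /e' eqxx.
  have := IHs h' e'; rewrite [X in X%:E](bigD1 j)//= e'j => IH.
  transitivity (\int[P]_x (\prod_i h' i (X i x))%:E); last first.
    rewrite [RHS]integral_mkcond; apply: eq_integral => x _; rewrite /patch.
    rewrite (bigD1 j)//= h'j indicE.
    have -> : (X j x \in B) = (x \in X j @^-1` B) by [].
    case: ifP => _; rewrite ?mul0r// mul1r; congr EFin.
    by apply: eq_bigr => i /negbTE ij; rewrite /h' ij.
  rewrite IH.
  + rewrite EFinM fineK ?fin_num_measure//; last exact: mpre.
    rewrite muleC. congr (_ * _); congr EFin.
    by apply: eq_bigr => i /negbTE ij; rewrite /e' ij.
  + move=> i ins; rewrite /h'; case: eqP => [_|/eqP ij]; first by exists B.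
    by apply: hs; rewrite inE negb_or ij.
  + move=> i; rewrite /h'; case: eqP => // _; exact: measurable_indic.
  + by move=> i y; rewrite /h'; case: eqP => // _; rewrite indicE.
  + move=> i; rewrite /h' /e'; case: eqP => [->|_]; last exact: he.
    rewrite fineK ?fin_num_measure//; last exact: mpre.
    transitivity (\int[P]_x (\1_(X j @^-1` B) x)%:E); first exact: eq_integral.
    by rewrite integral_indic ?setIT//; apply: mpre.
Qed.

Lemma std_normal_joint_mgf (I : finType) (X : I -> T -> R) (t : I -> R) :
  (forall i, std_normal_rv P (X i)) -> mutually_independent P X ->
  \int[P]_x (expR (\sum_i t i * X i x))%:E = (expR (\sum_i (t i) ^+ 2 / 2))%:E.
Proof.
move=> nX indX.
under eq_integral do rewrite expR_sum.
rewrite expR_sum.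
apply: (mutually_independent_expectation_prod
  (h := fun i y => expR (t i * y))%R) => //.
- by move=> i; exact: (nX i).1.
- by move=> i; apply: measurableT_comp => //; exact: measurable_funM.
- by move=> i; exact: std_normal_rv_mgf.
Qed.

End independence.

(** * Chi-square tails *)

Section cosh.
Context {R : realType}.

Let is_derive_le (f df : R -> R) : (forall x : R, is_derive x (1 : R) f (df x)) ->
  (forall x : R, 0 < x -> df x <= 0) -> forall x : R, 0 <= x -> f x <= f 0.
Proof.
move=> fdf df0 x; rewrite le_eqVlt => /predU1P[<-//|x0].
have cf : {within `[0, x], continuous f}.
  by apply: derivable_within_continuous => y _; have dy := fdf y; exact: ex_derive.
have [c /[!in_itv]/= /andP[c0 _] fE] := MVT x0 (fun y _ => fdf y) cf.
by rewrite -subr_le0 fE mulr_le0_ge0 ?df0// subr_ge0 ltW.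
Qed.

(** The product [g] of exp (- z ^ 2 / 2) and 2 cosh z does not increase for z >= 0: its derivative
    carries the factor (1 - z) exp z - (1 + z) exp (- z), which vanishes at 0 and has derivative - z
    (exp z - exp (- z)). *)
Lemma cosh_le_expR_sq (x : R) :
  (expR x + expR (- x)) / 2 <= expR (x ^+ 2 / 2).
Proof.
wlog x0 : x / 0 <= x.
  move=> H; have [/H//|/ltW x0] := leP 0 x.
  by have := H (- x); rewrite oppr_ge0 opprK sqrrN addrC; exact.
have sinh (y : R) : 0 < y -> (1 - y) * expR y - (1 + y) * expR (- y) <= 0.
  move=> y0.
  pose f (z : R) := (1 - z) * expR z - (1 + z) * expR (- z).
  rewrite -/(f y) (_ : 0 = f 0); last by rewrite /f; rewrite oppr0 expR0; ring.
  apply: (@is_derive_le f (fun z => - (z * (expR z - expR (- z))))) (ltW y0).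
    move=> z; rewrite /f; apply: is_derive_eq.
    by rewrite /GRing.scale/=; ring.
  move=> z z0; rewrite oppr_le0 mulr_ge0 ?(ltW z0)// subr_ge0 ler_expR; lra.
pose g (z : R) := expR (- (z ^+ 2 / 2)) * (expR z + expR (- z)).
have : g x <= g 0.
  apply: (@is_derive_le g (fun z => expR (- (z ^+ 2 / 2)) *
    ((1 - z) * expR z - (1 + z) * expR (- z)))) => //.
    move=> z; rewrite /g; apply: is_derive_eq.
    by rewrite /GRing.scale/=; field.
  by move=> z z0; rewrite mulr_ge0_le0 ?expR_ge0// sinh.
rewrite /g expr0n/= mul0r oppr0 expR0 mul1r mulrC (expRN (x ^+ 2 / 2)).
by rewrite ler_pdivrMr ?expR_gt0// ler_pdivrMr// mulrC.
Qed.

(* With [q = cosh x - 1], this is [expR (- x ^+ 2) <= (1 + q) ^- 2 <= 1 - 2 q + 3 q ^ 2].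
   A Gaussian factor is thus dominated by exponentials of linear forms, whose
   expectation agrees with it to first order. *)
Lemma expR_oppsq_le (x : R) :
  expR (- x ^+ 2) <= 15 / 2 - 4 * expR x - 4 * expR (- x)
    + 3 / 4 * expR (2 * x) + 3 / 4 * expR (- (2 * x)).
Proof.
set q := (expR x + expR (- x)) / 2 - 1.
have q0 : 0 <= q.
  have := expRxMexpNx_1 x; have := expR_gt0 x; have := expR_gt0 (- x).
  rewrite /q; set u := expR x; set v := expR (- x); move=> v0 u0 uv.
  have := mulr_ge0 (ltW v0) (sqr_ge0 (u - 1)).
  rewrite (_ : v * (u - 1) ^+ 2 = (u * v) * u - 2 * (u * v) + v); last by ring.
  by rewrite uv; lra.
have -> : 15 / 2 - 4 * expR x - 4 * expR (- x)
    + 3 / 4 * expR (2 * x) + 3 / 4 * expR (- (2 * x)) = 1 - 2 * q + 3 * q ^+ 2.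
  have e2 (y : R) : expR (2 * y) = expR y * expR y.
    by rewrite -expRD; congr expR; ring.
  have := expRxMexpNx_1 x; rewrite -(mulrN 2 x) !e2 /q.
  set u := expR x; set v := expR (- x) => uv; lra.
have le1q : (1 + q) ^+ 2 <= expR (x ^+ 2).
  have := cosh_le_expR_sq x; rewrite (_ : _ / 2 = 1 + q); last by rewrite /q; ring.
  move=> h; rewrite (_ : x ^+ 2 = x ^+ 2 / 2 + x ^+ 2 / 2); last by field.
  by rewrite expRD expr2 ler_pM// addr_ge0.
rewrite expRN; apply: (@le_trans _ _ ((1 + q) ^+ 2)^-1).
  by rewrite lef_pV2// posrE ?expR_gt0// exprn_gt0// ltr_pwDl.
rewrite -[leLHS]mul1r ler_pdivrMr; last by rewrite exprn_gt0// ltr_pwDl.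
nra.
Qed.

End cosh.

Section jointly_standard_normal.
Local Open Scope ereal_scope.
Context d (T : measurableType d) (R : realType) (P : probability T R).
Variables (n : nat) (y : 'I_n -> T -> R).
Hypothesis my : forall l, measurable_fun setT (y l).
Hypothesis mgf_y : forall t : 'I_n -> R,
  \int[P]_x (expR (\sum_l t l * y l x))%:E = (expR (\sum_l t l ^+ 2 / 2))%:E.

Let msq l : measurable_fun setT (fun x => y l x ^+ 2)%R.
Proof. by apply: measurable_funX. Qed.

(* [expR (a * y ^+ 2)] is the average of [expR (sqrt (2 * a) * g * y)] over an
   independent standard normal [g], which reduces squares to linear forms. *)
Lemma sumsq_mgf (a : R) : (0 <= a < 1 / 2)%R ->
  \int[P]_x (expR (a * \sum_l y l x ^+ 2))%:E =
  ((Num.sqrt (1 - 2 * a))^-1 ^+ n)%:E.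
Proof.
move=> /andP[a0 a1]; set M := ((Num.sqrt (1 - 2 * a))^-1)%R.
have M0 : (0 <= M)%R by rewrite invr_ge0 sqrtr_ge0.
(* A linear part is added so that squares can be traded one by one for linear terms. Since [t]
   vanishes on the remaining list, the traded coefficient of [y j] is exactly [c * g]. *)
suff H (s : seq 'I_n) : uniq s ->
    forall t : 'I_n -> R, (forall l, l \in s -> t l = 0%R) ->
    \int[P]_x (expR (a * \sum_(l <- s) y l x ^+ 2 + \sum_l t l * y l x))%:E =
    (M ^+ size s * expR (\sum_l t l ^+ 2 / 2))%:E.
  have := H (enum 'I_n) (enum_uniq _) (fun=> 0%R) (fun _ _ => erefl).
  rewrite [X in expR X]big1 ?expR0 ?mulr1; last first.
    by move=> l _; rewrite expr0n/= mul0r.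
  rewrite size_enum_ord => <-; apply: eq_integral => x _; rewrite big_enum/=.
  by rewrite [X in (_ + X)%R]big1 ?addr0// => l _; rewrite mul0r.
elim: s => [_ t _|j s IHs /= /andP[js us] t ts].
  by under eq_integral do rewrite big_nil mulr0 add0r; rewrite mul1r.
pose c := Num.sqrt (2 * a); have c2 : (c ^+ 2 = 2 * a)%R by rewrite sqr_sqrtr// mulr_ge0.
pose t' (g : R) l : R := (t l + (if l == j then c * g else 0))%R.
have t'E (g : R) (F : 'I_n -> R) : (\sum_l (if l == j then c * g else 0) * F l = c * g * F j)%R.
  rewrite (bigD1 j)//= eqxx big1 ?addr0// => l /negbTE ->.
  by rewrite mul0r.
pose f (z : T * R) :=
  (expR (a * \sum_(l <- s) y l z.1 ^+ 2 + \sum_l t' z.2 l * y l z.1))%:E.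
have mf : measurable_fun setT f.
  apply/measurable_EFinP; apply: measurableT_comp => //.
  have my1 l : measurable_fun setT (fun z : T * R => y l z.1).
    exact: measurableT_comp.
  apply: measurable_funD.
    apply: measurable_funM => //; apply: measurable_sum => l.
    exact: measurable_funX.
  apply: measurable_sum => l; apply: measurable_funM => //.
  rewrite /t'; apply: measurable_funD => //; case: (l == j) => //.
  exact: measurable_funM.
transitivity (\int[P]_x \int[normal_prob 0%R 1%R]_g f (x, g)).
  apply: eq_integral => x _; rewrite big_cons /f/=.
  under eq_integral => g _.
    rewrite (_ : _ + _ = (a * \sum_(l <- s) y l x ^+ 2 + \sum_l t l * y l x)
       + (c * y j x) * g)%R; last first.
      rewrite -addrA; congr (_ + _)%R.
      under eq_bigr do rewrite mulrDl.
      by rewrite big_split/= t'E mulrAC.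
    rewrite expRD EFinM; over.
  rewrite ge0_integralZl//.
  - rewrite normal_mgf -EFinM -expRD; congr (expR _)%:E.
    by rewrite exprMn c2; field.
  - apply/measurable_EFinP; apply: measurableT_comp => //.
have f0 z : 0 <= f z by rewrite lee_fin expR_ge0.
rewrite [LHS](@fubini_tonelli _ _ _ _ _ P (normal_prob 0%R 1%R) f mf f0).
have IH g : \int[P]_x f (x, g) =
    (M ^+ size s * expR (\sum_l t l ^+ 2 / 2))%:E * (expR (a * g ^+ 2))%:E.
  rewrite /f/= IHs//; last first.
    move=> l ls; rewrite /t' ts ?inE ?ls ?orbT//; case: eqP => [lj|]; last by rewrite addr0.
    by rewrite -lj ls in js.
  rewrite -EFinM -mulrA -expRD; congr (_ * expR _)%:E.
  transitivity (\sum_l (t l ^+ 2 / 2 + (if l == j then c * g else 0) * (if l == j then c * g / 2 else 0)))%R.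
    apply: eq_bigr => l _; rewrite /t'; case: eqP => [->|_]; last by rewrite addr0 mul0r addr0.
    by rewrite ts ?mem_head//; field.
  rewrite big_split/= t'E eqxx; congr (_ + _)%R.
  by rewrite mulrA -expr2 exprMn c2; field.
(* The coefficient [c * g] contributes (c g) ^ 2 / 2 = a g ^ 2 to the exponent, and E exp (a g ^ 2)
   is one factor [M]. *)
under eq_integral do rewrite IH.
rewrite ge0_integralZl//.
- rewrite normal_square_mgf// -EFinM -/M; congr EFin.
  by rewrite exprS; ring.
- apply/measurable_EFinP; apply: measurableT_comp => //.
  by apply: measurable_funM.
- by rewrite lee_fin mulr_ge0 ?expR_ge0// exprn_ge0.
Qed.

(** Each factor exp (- a y_l ^ 2) is dominated by five exponentials of multiples of y_l. The product
    expands, over maps into ['I_5], into exponentials of linear forms with known expectations, and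
    these resum to a power whose base is 1 - a to first order. *)
Lemma opp_sumsq_mgf_le (a : R) : (0 <= a)%R ->
  \int[P]_x (expR (- (a * \sum_l y l x ^+ 2)))%:E <=
  ((15 / 2 - 8 * expR (a / 2) + 3 / 2 * expR (2 * a)) ^+ n)%:E.
Proof.
move=> a0; pose s := Num.sqrt a; have s2 : (s ^+ 2 = a)%R by rewrite sqr_sqrtr.
pose w (i : 'I_5) : R := [:: 15 / 2; - 4; - 4; 3 / 4; 3 / 4]`_i.
pose v (i : 'I_5) : R := [:: 0; s; - s; 2 * s; - (2 * s)]%R`_i.
pose F (x : T) := (\sum_(f : {ffun 'I_n -> 'I_5})
  (\prod_l w (f l)) * expR (\sum_l v (f l) * y l x))%R.
have FE x : F x = (\prod_l \sum_i w i * expR (v i * y l x))%R.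
  rewrite bigA_distr_bigA; apply: eq_bigr => f _.
  by rewrite expR_sum -big_split.
have le_F x : (expR (- (a * \sum_l y l x ^+ 2)) <= F x)%R.
  rewrite FE mulr_sumr -sumrN expR_sum; apply: ler_prod => l _.
  rewrite expR_ge0/= !big_ord_recl big_ord0 /w /v/= mul0r expR0.
  have := expR_oppsq_le (s * y l x); rewrite exprMn s2 !mulNr !mulrA; lra.
have mF : measurable_fun setT F.
  apply: measurable_sum => f; apply: measurable_funM => //.
  apply: measurableT_comp => //; apply: measurable_sum => l.
  exact: measurable_funM.
apply: (@le_trans _ _ (\int[P]_x (F x)%:E)).
  apply: ge0_le_integral => //.
  - apply/measurable_EFinP; apply: measurableT_comp => //.
    apply: measurableT_comp => //; apply: measurable_funM => //.
    exact: measurable_sum.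
  - exact/measurable_EFinP.
  - by move=> x _; rewrite lee_fin.
have int_exp (t : 'I_n -> R) :
    P.-integrable setT (fun x => (expR (\sum_l t l * y l x))%:E).
  apply/integrableP; split.
    apply/measurable_EFinP; apply: measurableT_comp => //.
    by apply: measurable_sum => l; exact: measurable_funM.
  under eq_integral do rewrite gee0_abs ?lee_fin ?expR_ge0//.
  by rewrite mgf_y ltry.
rewrite /F; under eq_integral => x _.
  rewrite -sumEFin; under eq_bigr do rewrite EFinM; over.
rewrite integral_sum//; last by move=> f; apply: integrableZl.
under eq_bigr do rewrite integralZl// mgf_y -EFinM.
rewrite sumEFin lee_fin le_eqVlt; apply/orP; left; apply/eqP.
transitivity (\sum_(f : {ffun 'I_n -> 'I_5})
    \prod_l (w (f l) * expR (v (f l) ^+ 2 / 2)))%R.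
  by apply: eq_bigr => f _; rewrite expR_sum -big_split.
rewrite -(bigA_distr_bigA (fun _ i => w i * expR (v i ^+ 2 / 2))%R)/=.
rewrite prodr_const card_ord; congr (_ ^+ n)%R.
rewrite !big_ord_recl big_ord0 /w /v/= expr0n/= mul0r expR0.
rewrite !sqrrN !exprMn s2 (_ : 2 ^+ 2 * a / 2 = 2 * a)%R; last by field.
by lra.
Qed.
End jointly_standard_normal.

(** * Second-order bounds on the chi-square moment generating functions *)

Section chi_square_bounds.
Context {R : realType}.

(** After squaring and exp u >= 1 + u, what remains is (1 - 2 a) (1 + 2 a + 8 a ^ 2) >= 1, valid for
    a <= 1 / 4. The coefficient 11 in place of 4 matches [chi_square_mgf_lower]. *)
Lemma chi_square_mgf_upper (a : R) : 0 <= a <= 1 / 4 ->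
  (Num.sqrt (1 - 2 * a))^-1 <= expR (a + 11 * a ^+ 2).
Proof.
move=> /andP[a0 a1].
have le_sq : expR (- (a + 4 * a ^+ 2)) <= Num.sqrt (1 - 2 * a).
  rewrite -(ger0_norm (expR_ge0 _)) -sqrtr_sqr ler_wsqrtr// expRN exprVn.
  rewrite -[leLHS]mul1r ler_pdivrMr ?exprn_gt0 ?expR_gt0//.
  rewrite -expRM_natl; have := expR_ge1Dx (2%:R * (a + 4 * a ^+ 2)) => h.
  apply: le_trans (ler_wpM2l _ h); last by lra.
  by nra.
apply: (@le_trans _ _ (expR (a + 4 * a ^+ 2))).
  rewrite -[leRHS]invrK lef_pV2 -?expRN// posrE ?sqrtr_gt0 ?expR_gt0//.
  by lra.
by rewrite ler_expR; nra.
Qed.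

Lemma chi_square_mgf_lower (a : R) : 0 <= a <= 1 / 4 ->
  0 <= 15 / 2 - 8 * expR (a / 2) + 3 / 2 * expR (2 * a) <= expR (11 * a ^+ 2 - a).
Proof.
move=> /andP[a0 a1].
suff /andP[-> le1] : 0 <= 15 / 2 - 8 * expR (a / 2) + 3 / 2 * expR (2 * a) <=
    1 + (11 * a ^+ 2 - a) by exact: le_trans le1 (expR_ge1Dx _).
have e4 : expR (2 * a) = expR (a / 2) ^+ 4.
  by rewrite -expRM_natl; congr expR; field.
rewrite e4; set z := expR (a / 2).
have z1 : 1 + a / 2 <= z by exact: expR_ge1Dx.
have z2 : z * (1 - a / 2) <= 1.
  rewrite -[leRHS](expRxMexpNx_1 (a / 2)) ler_wpM2l ?expR_ge0 ?expR_ge1Dx//.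
have [e ze] : exists e, z = 1 + e by exists (z - 1); rewrite addrC subrK.
rewrite ze in z1 z2 *.
have e1 : e <= 4 / 7 * a by nra.
have e0 : a / 2 <= e by lra.
have e7 : e <= 1 / 7 by lra.
(* In the variable e = exp (a / 2) - 1 the linear term is - 2 e <= - a, and the rest is at most 10 e
   ^ 2 <= 10 a ^ 2. *)
have -> : 15 / 2 - 8 * (1 + e) + 3 / 2 * (1 + e) ^+ 4 =
  1 - 2 * e + e ^+ 2 * (9 + 6 * e + 3 / 2 * e ^+ 2) by field.
have ege0 : 0 <= e by lra.
have : 0 <= e ^+ 2 * (9 + 6 * e + 3 / 2 * e ^+ 2).
  by rewrite mulr_ge0 ?sqr_ge0// !addr_ge0 ?mulr_ge0 ?sqr_ge0.
have : e ^+ 2 * (9 + 6 * e + 3 / 2 * e ^+ 2) <= e ^+ 2 * 10.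
  by apply: ler_wpM2l; [exact: sqr_ge0|nra].
have : e ^+ 2 <= a ^+ 2 by rewrite lerXn2r ?nnegrE//; lra.
by move=> h1 h2 h3; apply/andP; split; lra.
Qed.

End chi_square_bounds.

Section chi_square_tail.
Local Open Scope ereal_scope.
Context d (T : measurableType d) (R : realType) (P : probability T R).

Lemma chernoff (f : T -> R) (b : R) : measurable_fun setT f ->
  P [set x | (b <= f x)%R] <= (expR (- b))%:E * \int[P]_x (expR (f x))%:E.
Proof.
move=> mf.
have mA : measurable [set x | (b <= f x)%R].
  by rewrite -[X in measurable X]setTI; exact: measurable_fun_le.
have mexp : measurable_fun setT (fun x => (expR (f x))%:E).
  by apply/measurable_EFinP; exact: measurableT_comp.
rewrite -ge0_integralZl//.
rewrite (_ : P _ = \int[P]_x (\1_[set x | (b <= f x)%R] x)%:E); last first.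
  by rewrite integral_indic ?setIT.
apply: ge0_le_integral => //.
- by apply/measurable_EFinP; exact: measurable_indic.
- by apply: emeasurable_funM => //; exact: measurable_cst.
move=> x _; rewrite -EFinM -expRD lee_fin indicE.
have [|_] := boolP (x \in _); last by rewrite expR_ge0.
by rewrite inE/= => bf; rewrite -[leLHS]expR0 ler_expR addrC subr_ge0.
Qed.

Variables (n : nat) (y : 'I_n -> T -> R).
Hypothesis my : forall l, measurable_fun setT (y l).
Hypothesis mgf_y : forall t : 'I_n -> R,
  \int[P]_x (expR (\sum_l t l * y l x))%:E = (expR (\sum_l t l ^+ 2 / 2))%:E.

Let Z x : R := (\sum_l y l x ^+ 2 - n%:R)%R.

Let mZ : measurable_fun setT Z.
Proof.
apply: measurable_funB => //; apply: measurable_sum => l.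
exact: measurable_funX.
Qed.

Lemma chi_square_tail (x : R) : (0 < n)%N -> (0 <= x)%R ->
  P [set w | (12 * Num.sqrt (n%:R * x) + 48 * x < `|Z w|)%R] <=
  (2 * expR (- x))%:E.
Proof.
move=> n0 x0; set t := (_ + 48 * x)%R.
have nR : (0 < n%:R :> R)%R by rewrite ltr0n.
(* The Chernoff parameter is min (sqrt (x / n), 1 / 4). In the first regime 11 n a ^ 2 = 11 x is set
   against 12 a sqrt (n x) = 12 x; in the second, n < 16 x gives 11 n / 16 <= 11 x against 48 x / 4
   = 12 x. This fixes the constants 12 and 48. *)
have [a [a0 a1 at_x]] : exists a : R,
    [/\ (0 <= a)%R, (a <= 1 / 4)%R & (11 * n%:R * a ^+ 2 - a * t <= - x)%R].
  have s0 : (0 <= Num.sqrt (n%:R * x))%R by exact: sqrtr_ge0.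
  have s2 : (Num.sqrt (n%:R * x) ^+ 2 = n%:R * x)%R.
    by rewrite sqr_sqrtr// mulr_ge0.
  have [xn|xn] := leP (16 * x)%R n%:R.
    exists (Num.sqrt (n%:R * x) / n%:R)%R.
    have a2 : ((Num.sqrt (n%:R * x) / n%:R) ^+ 2 = x / n%:R)%R.
      by rewrite expr_div_n s2; field; rewrite gt_eqF.
    split; first by rewrite divr_ge0.
      rewrite -(@ler_pXn2r _ 2)// ?nnegrE ?divr_ge0// a2 ler_pdivrMr//; lra.
    rewrite a2 /t mulrDr.
    have -> : (Num.sqrt (n%:R * x) / n%:R * (12 * Num.sqrt (n%:R * x)) = 12 * x)%R.
      by rewrite mulrCA mulrAC -expr2 s2; field; rewrite gt_eqF.
    have -> : (11 * n%:R * (x / n%:R) = 11 * x)%R by field; rewrite gt_eqF.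
    have : (0 <= Num.sqrt (n%:R * x) / n%:R * (48 * x))%R.
      by rewrite mulr_ge0// ?divr_ge0// mulr_ge0.
    lra.
  exists (1 / 4)%R; split; [lra|lra|rewrite /t; lra].
have mgfZ (b : R) : (b = a \/ b = - a)%R ->
    \int[P]_w (expR (b * Z w))%:E <= (expR (11 * n%:R * a ^+ 2))%:E.
  have ZE b' : \int[P]_w (expR (b' * Z w))%:E =
      (expR (- (b' * n%:R)))%:E * \int[P]_w (expR (b' * \sum_l y l w ^+ 2))%:E.
    rewrite -ge0_integralZl//.
    - by apply: eq_integral => w _; rewrite -EFinM -expRD /Z mulrBr addrC.
    - apply/measurable_EFinP; apply: measurableT_comp => //.
      apply: measurable_funM => //; apply: measurable_sum => l.
      exact: measurable_funX.
  have nE (u v : R) : (expR (- (u * n%:R)) * (expR v) ^+ n = expR (n%:R * (v - u)))%R.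
    by rewrite -expRM_natl -expRD; congr expR; ring.
  have eE : expR (11 * n%:R * a ^+ 2) = expR (n%:R * (a + 11 * a ^+ 2 - a)).
    by congr expR; ring.
  have eE' : expR (11 * n%:R * a ^+ 2) = expR (n%:R * (11 * a ^+ 2 - a - - a)).
    by congr expR; ring.
  move=> [->|->]; rewrite ZE.
    rewrite sumsq_mgf//; last by apply/andP; split => //; lra.
    rewrite -EFinM lee_fin eE -nE ler_wpM2l ?expR_ge0//.
    rewrite lerXn2r ?nnegrE ?invr_ge0 ?sqrtr_ge0 ?expR_ge0//.
    by apply: chi_square_mgf_upper; rewrite a0.
  under eq_integral do rewrite mulNr.
  apply: le_trans (lee_wpmul2l _ (opp_sumsq_mgf_le my mgf_y a0)) _.
    by rewrite lee_fin expR_ge0.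
  rewrite -EFinM lee_fin eE' -nE ler_wpM2l ?expR_ge0//.
  have /andP[X0 Xle] : (0 <= 15 / 2 - 8 * expR (a / 2) + 3 / 2 * expR (2 * a)
      <= expR (11 * a ^+ 2 - a))%R by apply: chi_square_mgf_lower; rewrite a0.
  by rewrite lerXn2r ?nnegrE ?expR_ge0.
have tail (b : R) : (b = a \/ b = - a)%R ->
    P [set w | (a * t <= b * Z w)%R] <= (expR (- x))%:E.
  move=> ba; apply: le_trans (chernoff _ _) _; first exact: measurable_funM.
  apply: le_trans (lee_wpmul2l _ (mgfZ _ ba)) _; first by rewrite lee_fin expR_ge0.
  by rewrite -EFinM -expRD lee_fin ler_expR addrC.
have mA (b : R) : measurable [set w | (a * t <= b * Z w)%R].
  rewrite -[X in measurable X]setTI; apply: measurable_fun_le => //.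
  exact: measurable_funM.
apply: (@le_trans _ _ (P ([set w | (a * t <= a * Z w)%R] `|`
    [set w | (a * t <= - a * Z w)%R]))).
  apply: le_measure; rewrite ?inE.
  - rewrite (_ : [set w | _] = ~` [set w | (`|Z w| <= t)%R]); last first.
      by apply/seteqP; split => w /=; rewrite ltNge => /negP.
    apply: measurableC; rewrite -[X in measurable X]setTI.
    by apply: measurable_fun_le => //; exact: measurableT_comp.
  - exact: measurableU.
  move=> w /= tZ; have [Z0|Z0] := leP 0%R (Z w).
    left; apply: ler_wpM2l => //; apply: ltW; by rewrite -(ger0_norm Z0).
  right; rewrite mulNr -mulrN; apply: ler_wpM2l => //; apply: ltW.
  by rewrite -(ltr0_norm Z0).
apply: le_trans (measureU2 _ (mA _) (mA _)) _.
by rewrite mulr2n mulrDl mul1r EFinD leeD// tail//; [left|right].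
Qed.

End chi_square_tail.

(** * Deviation events for squared linear forms of i.i.d. normals *)

Section gaussian_quadratic_form.
Local Open Scope ereal_scope.
Context d (T : measurableType d) (R : realType) (P : probability T R).

Lemma measure_bigsetU_le (I : finType) (Q : pred I) (B : I -> set T) (p : I -> R) :
  (forall i, measurable (B i)) -> (forall i, P (B i) <= (p i)%:E) ->
  P (\big[setU/set0]_(i | Q i) B i) <= (\sum_(i | Q i) p i)%:E.
Proof.
move=> mB PB.
suff [] : measurable (\big[setU/set0]_(i | Q i) B i) /\
  P (\big[setU/set0]_(i | Q i) B i) <= (\sum_(i | Q i) p i)%:E by [].
elim/big_ind2 : _ => [|A x C y [mA Ax] [mC Cy]|i _].
- by split => //; rewrite measure0.
- split; first exact: measurableU.
  by apply: le_trans (measureU2 _ mA mC) _; rewrite EFinD leeD.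
- by split.
Qed.

Variables (n : nat) (J : finType) (xi : 'I_n -> J -> T -> R).
Hypothesis nxi : forall l r, std_normal_rv P (xi l r).
Hypothesis indep_xi :
  mutually_independent P (fun lr : 'I_n * J => xi lr.1 lr.2).

(** Both sides are quadratic in [u], so the threshold is relative to the variance of the form; the
    strict inequality makes the event empty for u = 0. *)
Definition quadratic_deviation (u : J -> R) (x : R) : set T :=
  [set w | ((\sum_r u r ^+ 2) * (12 * Num.sqrt (n%:R * x) + 48 * x) <
    `|\sum_l (\sum_r u r * xi l r w) ^+ 2 - n%:R * \sum_r u r ^+ 2|)%R].

Let mlin (u : J -> R) l : measurable_fun setT (fun w => \sum_r u r * xi l r w)%R.
Proof.
apply: measurable_sum => r; apply: measurable_funM => //; exact: (nxi l r).1.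
Qed.

Lemma measurable_quadratic_deviation u x : measurable (quadratic_deviation u x).
Proof.
rewrite /quadratic_deviation; set a := (_ * (_ + _))%R; set b := (n%:R * _)%R.
rewrite (_ : [set w | _] =
  ~` [set w | (`|\sum_l (\sum_r u r * xi l r w) ^+ 2 - b| <= a)%R]); last first.
  by apply/seteqP; split => w /=; rewrite ltNge => /negP.
apply: measurableC; rewrite -[X in measurable X]setTI.
apply: measurable_fun_le => //; apply: measurableT_comp => //.
apply: measurable_funB => //; apply: measurable_sum => l.
exact: measurable_funX.
Qed.

(** Dividing by the standard deviation gives variables [y l] with the joint moment identity, because
    any combination of them is a single linear form in all the [xi l r]. The zero form cannot be
    normalized and is treated apart. *)
Lemma quadratic_deviation_prob u x : (0 < n)%N -> (0 <= x)%R ->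
  P (quadratic_deviation u x) <= (2 * expR (- x))%:E.
Proof.
move=> n0 x0; set t := (\sum_r u r ^+ 2)%R.
have t_ge0 : (0 <= t)%R by apply: sumr_ge0 => r _; exact: sqr_ge0.
have := t_ge0; rewrite le_eqVlt => /predU1P[t0|t0].
  have u0 r : u r = 0%R.
    apply/eqP; rewrite -sqrf_eq0; apply/eqP.
    by apply: (psumr_eq0P _ (esym t0)) => // i _; exact: sqr_ge0.
  rewrite (_ : quadratic_deviation u x = set0).
    by rewrite measure0 lee_fin mulr_ge0// expR_ge0.
  apply/seteqP; split => w //=; rewrite /quadratic_deviation/= -/t -t0 mul0r mulr0 subr0.
  rewrite big1 ?normr0 ?ltxx// => l _.
  by rewrite big1 ?expr0n// => r _; rewrite u0 mul0r.
set s := Num.sqrt t; have s0 : (0 < s)%R by rewrite sqrtr_gt0.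
have s2 : (s ^+ 2 = t)%R by rewrite sqr_sqrtr.
pose y l w := ((\sum_r u r * xi l r w) / s)%R.
have my l : measurable_fun setT (y l) by exact: measurable_funM.
have mgf_y (v : 'I_n -> R) :
    \int[P]_w (expR (\sum_l v l * y l w))%:E = (expR (\sum_l v l ^+ 2 / 2))%:E.
  under eq_integral => w _.
    rewrite (_ : \sum_l _ = \sum_(lr : 'I_n * J)
      (v lr.1 * u lr.2 / s) * xi lr.1 lr.2 w)%R; last first.
      rewrite -(pair_bigA _ (fun l r => (v l * u r / s) * xi l r w)%R)/=.
      apply: eq_bigr => l _; rewrite /y mulrA mulr_sumr mulr_suml.
      by apply: eq_bigr => r _; ring.
    over.
  rewrite (std_normal_joint_mgf (fun lr : 'I_n * J => v lr.1 * u lr.2 / s)%R _ indep_xi)//.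
  congr (expR _)%:E.
  rewrite -(pair_bigA _ (fun l r => (v l * u r / s) ^+ 2 / 2)%R)/=.
  apply: eq_bigr => l _.
  transitivity (v l ^+ 2 / 2 / s ^+ 2 * \sum_r u r ^+ 2)%R.
    rewrite mulr_sumr; apply: eq_bigr => r _; field; by rewrite gt_eqF.
  by rewrite -/t s2 mulfVK// gt_eqF.
apply: le_trans (chi_square_tail my mgf_y n0 x0).
rewrite (_ : quadratic_deviation u x = [set w | (12 * Num.sqrt (n%:R * x) + 48 * x <
    `|\sum_l y l w ^+ 2 - n%:R|)%R])//.
apply/funext => w; rewrite /quadratic_deviation/= -/t; congr is_true.
rewrite (_ : \sum_l (\sum_r u r * xi l r w) ^+ 2 - n%:R * t =
  t * (\sum_l y l w ^+ 2 - n%:R))%R.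
  by rewrite normrM (gtr0_norm t0) ltr_pM2l.
rewrite mulrBr (mulrC t n%:R); congr (_ - _)%R.
rewrite mulr_sumr; apply: eq_bigr => l _; rewrite /y expr_div_n s2 mulrCA mulfV ?mulr1// gt_eqF//.
Qed.

End gaussian_quadratic_form.

(** * Quadratic forms on a lattice net *)

Section net.
Context {R : realType} (d : nat).

(* The points of the net are the integer vectors of l1-norm at most [25 * d], given
   by signs and magnitudes (zero coordinates have two representations). *)
Definition net_point (phi : {ffun 'I_d -> bool * 'I_(25 * d).+1}) (a : 'I_d) : R :=
  (-1) ^+ (phi a).1 * (phi a).2%:R.

Definition net := [pred phi : {ffun 'I_d -> bool * 'I_(25 * d).+1} |
  (\sum_a (phi a).2 <= 25 * d)%N].

Lemma sum_half_pow_le N : \sum_(i < N) (1 / 2 : R) ^+ i <= 2.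
Proof.
have -> : \sum_(i < N) (1 / 2 : R) ^+ i = 2 - 2 * (1 / 2) ^+ N.
  elim: N => [|N IH]; first by rewrite big_ord0 expr0 mulr1 subrr.
  by rewrite big_ord_recr /= IH exprS; field.
by rewrite gerBl mulr_ge0// exprn_ge0// divr_ge0.
Qed.

(* [1 <= 2 ^ (25 d) * \prod_a 2 ^ (- |z_a|)] on the net, and the sum of the
   right-hand side over all [z] factorizes. *)
Lemma card_net : (#|net|%:R : R) <= 2 ^+ (27 * d).
Proof.
have le_wt phi : phi \in net ->
    1 <= (2 : R) ^+ (25 * d) * \prod_(a < d) (1 / 2) ^+ (phi a).2.
  rewrite inE => le_phi; rewrite prodrXr div1r exprVn.
  by rewrite ler_pdivlMr ?exprn_gt0// mul1r ler_weXn2l// ler1n.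
rewrite -sum1_card natr_sum.
apply: le_trans (ler_sum _ le_wt) _.
apply: (@le_trans _ _ (\sum_(phi : {ffun 'I_d -> bool * 'I_(25 * d).+1}) (2 : R) ^+ (25 * d) *
    \prod_(a < d) (1 / 2) ^+ (phi a).2)).
  rewrite big_mkcond; apply: ler_sum => phi _; case: ifP => // _.
  by rewrite mulr_ge0 ?exprn_ge0// prodr_ge0// => a _; rewrite exprn_ge0// divr_ge0.
rewrite -mulr_sumr -(bigA_distr_bigA (fun _ (i : bool * 'I_(25 * d).+1) => (1 / 2 : R) ^+ i.2)).
(* 27 = 25 + 2: one coordinate contributes two signs times a geometric series of sum at most 2,
   hence at most 4 = 2 ^ 2. *)
rewrite prodr_const card_ord (mulnDl 25 2) exprD ler_wpM2l ?exprn_ge0//.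
rewrite exprM lerXn2r ?nnegrE ?exprn_ge0//.
  by apply: sumr_ge0 => i _; rewrite exprn_ge0// divr_ge0.
rewrite -(pair_bigA _ (fun (b : bool) (i : 'I_(25 * d).+1) => (1 / 2 : R) ^+ i))/=.
rewrite sumr_const card_bool expr2 mulr_natl lerMn2r/=.
exact: sum_half_pow_le.
Qed.

Section quadratic_form.
Variable M : 'I_d -> 'I_d -> R.
Hypothesis symM : forall a b, M a b = M b a.

Definition bilin (u v : 'I_d -> R) := \sum_a \sum_b u a * M a b * v b.

Let sqn (u : 'I_d -> R) := \sum_a u a ^+ 2.

Let bilinC u v : bilin u v = bilin v u.
Proof.
rewrite /bilin exchange_big; apply: eq_bigr => a _; apply: eq_bigr => b _.
by rewrite symM; ring.
Qed.

Let bilinZ (c e : R) u v :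
  bilin (fun a => c * u a) (fun a => e * v a) = c * e * bilin u v.
Proof.
rewrite /bilin mulr_sumr; apply: eq_bigr => a _.
by rewrite mulr_sumr; apply: eq_bigr => b _; ring.
Qed.

Let bilinDD (e : R) u v :
  bilin (fun a => u a + e * v a) (fun a => u a + e * v a) =
  bilin u u + 2 * e * bilin u v + e ^+ 2 * bilin v v.
Proof.
rewrite mulrAC mulr2n mulrDl mul1r mulrDl {2}(bilinC u v).
rewrite /bilin !(mulr_suml, mulr_sumr) -!big_split/=; apply: eq_bigr => a _.
by rewrite !(mulr_suml, mulr_sumr) -!big_split/=; apply: eq_bigr => b _; ring.
Qed.

Let bilinBD u v :
  bilin (fun a => u a + -1 * v a) (fun a => u a + 1 * v a) =
  bilin u u - bilin v v.
Proof.
rewrite -[bilin u u](addrK (bilin u v)) [in X in _ - X - _](bilinC u v).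
rewrite /bilin -!sumrN -!big_split/=; apply: eq_bigr => a _.
by rewrite -!sumrN -!big_split/=; apply: eq_bigr => b _; ring.
Qed.

(** Polarization, then the parallelogram law for [sqn]. *)
Let bilin_le (L : R) : (forall u, `|bilin u u| <= L * sqn u) ->
  forall u v, `|bilin u v| <= L / 2 * (sqn u + sqn v).
Proof.
move=> hL u v.
have sqD (e : R) : e ^+ 2 = 1 ->
    sqn (fun a => u a + e * v a) = sqn u + sqn v + 2 * e * \sum_a u a * v a.
  move=> e2; rewrite /sqn mulr_sumr -!big_split/=; apply: eq_bigr => a _.
  by rewrite sqrrD exprMn e2 mul1r; ring.
have := hL (fun a => u a + 1 * v a); have := hL (fun a => u a + (-1) * v a).
rewrite !bilinDD !sqD ?sqrrN ?expr1n// !ler_norml.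
by move=> /andP[h1 h2] /andP[h3 h4]; apply/andP; split; lra.
Qed.

Let sqnZ (c : R) u : sqn (fun a => c * u a) = c ^+ 2 * sqn u.
Proof. by rewrite /sqn mulr_sumr; apply: eq_bigr => a _; rewrite exprMn. Qed.

(** A starting value for the iteration of [net_step]; its size disappears under repeated halving. *)
Let crude (u : 'I_d -> R) :
  `|bilin u u| <= (\sum_a \sum_b `|M a b|) * sqn u.
Proof.
have u_le a : u a ^+ 2 <= sqn u.
  rewrite /sqn (bigD1 a)//= lerDl; apply: sumr_ge0 => b _; exact: sqr_ge0.
rewrite mulr_suml; apply: le_trans (ler_norm_sum _ _ _) _.
apply: ler_sum => a _; rewrite mulr_suml.
apply: le_trans (ler_norm_sum _ _ _) _; apply: ler_sum => b _.
rewrite !normrM mulrAC mulrC; apply: ler_wpM2l => //.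
have := u_le a; have := u_le b; rewrite -(real_normK (num_real (u a))).
rewrite -(real_normK (num_real (u b))).
have := sqr_ge0 (`|u a| - `|u b|); rewrite sqrrB; lra.
Qed.

Variable B : R.
Hypothesis B0 : 0 <= B.
Hypothesis netB : forall phi, phi \in net ->
  `|bilin (net_point phi) (net_point phi)| <= B * sqn (net_point phi).

(* Rescale [u] to squared norm [25 * d] and round its coordinates towards zero: the
   squared norm of the error is at most [d], and a vector of integers has l1-norm at
   most its squared norm, so the result is in the net. *)
Let net_step (L : R) : 0 <= L -> (forall u, `|bilin u u| <= L * sqn u) ->
  forall u, `|bilin u u| <= (B + L / 2) * sqn u.
Proof.
move=> L0 hL u.
have sq_ge0 v : 0 <= sqn v by apply: sumr_ge0 => a _; exact: sqr_ge0.
have := sq_ge0 u; rewrite le_eqVlt => /predU1P[u0|u0].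
  by have := hL u; rewrite -u0 !mulr0.
have d0 : (0 < d)%N.
  case: (posnP d) => // d0; move: u0; rewrite /sqn big1 ?ltxx// => a.
  by have := ltn_ord a; rewrite {2}d0.
have dR : (0 < d%:R :> R) by rewrite ltr0n.
pose s := 5 * Num.sqrt (d%:R / sqn u).
have s2 : s ^+ 2 * sqn u = 25 * d%:R.
  rewrite exprMn sqr_sqrtr ?divr_ge0 ?ltW//; field; by rewrite gt_eqF.
have s0 : 0 < s by rewrite mulr_gt0// sqrtr_gt0 divr_gt0.
pose x a := s * u a.
pose mag a := Num.truncn `|x a|.
have mag_le a : (mag a)%:R <= `|x a| by rewrite truncn_le.
have mag_lt a : `|x a| < (mag a)%:R + 1 by rewrite natr1; exact: truncnS_gt.
have sqx : sqn x = 25 * d%:R by rewrite /x sqnZ.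
have mag_sum : (\sum_a mag a <= 25 * d)%N.
  rewrite -(@ler_nat R) natr_sum natrM -sqx; apply: ler_sum => a _.
  apply: (@le_trans _ _ ((mag a)%:R ^+ 2)).
    by rewrite -natrX ler_nat; case: (mag a) => // k; rewrite leq_pmulr.
  by rewrite -(real_normK (num_real (x a))) lerXn2r ?nnegrE.
have mag_ord a : (mag a < (25 * d).+1)%N.
  rewrite ltnS; apply: leq_trans mag_sum.
  by rewrite (bigD1 a)//= leq_addr.
pose phi := [ffun a => (x a < 0, inord (mag a) : 'I_(25 * d).+1)].
have phi_net : phi \in net.
  rewrite inE; apply: leq_trans mag_sum; apply: leq_sum => a _.
  by rewrite ffunE/= inordK.
set z := net_point phi.
have zE a : z a = (-1) ^+ (x a < 0)%R * (mag a)%:R by rewrite /z /net_point ffunE/= inordK.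
have xE (a : 'I_d) : x a = (-1) ^+ (x a < 0)%R * `|x a| by exact: (numEsign (x a)).
have sgn2 a : ((-1 : R) ^+ (x a < 0)%R) ^+ 2 = 1 by rewrite sqrr_sign.
have z_le : sqn z <= sqn x.
  apply: ler_sum => a _; rewrite zE exprMn sgn2 mul1r.
  by rewrite -(real_normK (num_real (x a))) lerXn2r ?nnegrE.
have r_le : sqn (fun a => x a + -1 * z a) <= d%:R.
  apply: (@le_trans _ _ (\sum_(a < d) 1)); last by rewrite sumr_const card_ord.
  apply: ler_sum => a _; rewrite zE {1}xE mulrCA -mulrDr exprMn sgn2 mul1r.
  have := mag_le a; have := mag_lt a => h1 h2.
  by rewrite -[leRHS](expr1n _ 2) lerXn2r ?nnegrE//; lra.
have y_le : sqn (fun a => x a + 1 * z a) <= 100 * d%:R.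
  apply: (@le_trans _ _ (4 * sqn x)); last by rewrite sqx; lra.
  rewrite /sqn mulr_sumr; apply: ler_sum => a _.
  rewrite zE {1}xE mulrCA -mulrDr exprMn sgn2 mul1r.
  rewrite -(real_normK (num_real (x a))).
  have := mag_le a; have : 0 <= (mag a)%:R :> R by [].
  by move=> h1 h2; nra.
have diff : `|bilin x x - bilin z z| <= 10 * L * d%:R.
  rewrite -bilinBD; set r := fun a => x a + -1 * z a; set y := fun a => x a + 1 * z a.
  (* The weight 10 balances the bounds d and 100 d on the squared norms of [r] and [y], so rounding
     costs at most 10 L d. Relative to the squared norm 25 d this is 2 / 5 of L, below the 1 / 2
     required. *)
  have := bilin_le hL (fun a => 10 * r a) (fun a => 1 * y a).
  rewrite bilinZ mulr1 normrM ger0_norm// !sqnZ expr1n mul1r => h.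
  have : L * (10 ^+ 2 * sqn r + sqn y) <= L * (10 ^+ 2 * d%:R + 100 * d%:R).
    by apply: ler_wpM2l => //; apply: lerD => //; apply: ler_wpM2l.
  lra.
have netz : `|bilin z z| <= B * (25 * d%:R).
  by apply: le_trans (netB phi_net) _; rewrite -sqx ler_wpM2l.
have xx : `|bilin x x| <= (B + L / 2) * (25 * d%:R).
  have : `|bilin x x| <= `|bilin x x - bilin z z| + `|bilin z z|.
    by rewrite -{1}(subrK (bilin z z) (bilin x x)) ler_normD.
  have : 0 <= L * d%:R by rewrite mulr_ge0.
  lra.
have ss : `|s * s| = s ^+ 2 by rewrite -expr2 ger0_norm ?sqr_ge0.
move: xx; rewrite /x bilinZ normrM ss -s2 mulrCA ler_pM2l// exprn_gt0//.
Qed.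

(** The map L |-> B + L / 2 of [net_step] has fixed point 2 B; iterating it from the crude bound
    leaves an excess L0 / 2 ^ k that tends to 0. *)
Lemma net_quadratic_form_le u : `|bilin u u| <= 2 * B * sqn u.
Proof.
pose L0 := \sum_a \sum_b `|M a b|.
have L0_ge0 : 0 <= L0 by apply: sumr_ge0 => a _; apply: sumr_ge0.
have sq_ge0 : 0 <= sqn u by apply: sumr_ge0 => a _; exact: sqr_ge0.
have H k v : `|bilin v v| <= (2 * B + L0 / 2 ^+ k) * sqn v.
  elim: k v => [|k IH] v.
    rewrite expr0 divr1; apply: le_trans (crude v) _.
    apply: ler_wpM2r; first by apply: sumr_ge0 => a _; exact: sqr_ge0.
    by rewrite lerDr mulr_ge0.
  have := net_step _ IH v; rewrite (_ : B + _ = 2 * B + L0 / 2 ^+ k.+1).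
    by apply; rewrite addr_ge0 ?mulr_ge0 ?invr_ge0 ?exprn_ge0.
  by rewrite exprS; field; rewrite expf_neq0.
apply/ler_addgt0Pr => e e0.
pose k := (Num.truncn (L0 * sqn u / e)).+1.
apply: le_trans (H k u) _; rewrite mulrDl lerD2l mulrAC ler_pdivrMr ?exprn_gt0//.
rewrite -ler_pdivrMl// mulrC; apply: ltW; apply: lt_trans (truncnS_gt _) _.
by rewrite -natrX ltr_nat ltn_expl.
Qed.

End quadratic_form.
End net.

(** * Algebra of the certificate *)

Section certificate_algebra.
Context {R : realType} (d K : nat) (lab : 'I_d -> 'I_K).

Lemma sum_cluster_const (i : 'I_K) (c : R) :
  \sum_(a | lab a == i) c = c * (clsize lab i)%:R.
Proof.
rewrite sumr_const mulr_natr /clsize; congr (_ *+ _).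
apply: eq_card => a; apply/idP/idP => h; first exact: mem_set.
exact: (set_mem h).
Qed.

Lemma sum_diff_coef (F : 'I_d -> R) a b :
  \sum_c ((c == a)%:R - (c == b)%:R) * F c = F a - F b.
Proof.
under eq_bigr do rewrite mulrBl; rewrite sumrB; congr (_ - _).
  by rewrite (bigD1 a)//= eqxx mul1r big1 ?addr0// => c /negbTE ->; rewrite mul0r.
by rewrite (bigD1 b)//= eqxx mul1r big1 ?addr0// => c /negbTE ->; rewrite mul0r.
Qed.

(* [Q_i] is the compression of [D_i + yT I] to the orthogonal complement of the
   constant vectors. *)
Lemma Qcert_form (D : 'M[R]_d) (yT : R) (i : 'I_K) (u : 'I_d -> R) :
  (forall a b, D a b = D b a) -> (0 < clsize lab i)%N ->
  let v a := if lab a == i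
    then u a - (\sum_(c | lab c == i) u c) / (clsize lab i)%:R else 0 in
  \sum_(a | lab a == i) \sum_(b | lab b == i) u a * Qcert lab D yT a b * u b =
  \sum_a \sum_b v a * D a b * v b + yT * \sum_a v a ^+ 2.
Proof.
move=> symD ni0; set N : R := (clsize lab i)%:R; set U := \sum_(c | _) u c.
have N0 : N != 0 by rewrite pnatr_eq0 -lt0n.
pose row a := \sum_(b | lab b == i) D a b.
pose tot := \sum_(a | lab a == i) row a.
pose ru := \sum_(a | lab a == i) u a * row a.
pose Duu := \sum_(a | lab a == i) \sum_(b | lab b == i) u a * D a b * u b.
pose y a := tot / (2 * N ^+ 2) - row a / N - yT / (2 * N).
pose uy := \sum_(a | lab a == i) u a * y a.
have yE a : lab a == i -> ycert lab D yT a = y a.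
  by move=> /eqP ai; rewrite /ycert /y ai.
have uyE : uy = U * tot / (2 * N ^+ 2) - ru / N - U * yT / (2 * N).
  rewrite /uy /ru !mulr_suml -!sumrN -!big_split/=; apply: eq_bigr => a _.
  by rewrite /y; ring.
have LE : \sum_(a | lab a == i) \sum_(b | lab b == i) u a * Qcert lab D yT a b * u b =
    Duu + U * uy + uy * U + yT * \sum_(a | lab a == i) u a ^+ 2.
  rewrite /Duu {1}/U {2}/uy !mulr_suml mulr_sumr -!big_split/=.
  apply: eq_bigr => a ai; rewrite /uy /U !mulr_sumr.
  rewrite (_ : yT * u a ^+ 2 =
      \sum_(b | lab b == i) (if a == b then yT * u a * u b else 0)); last first.
    rewrite (bigD1 a)//= eqxx big1 ?addr0; first by ring.
    by move=> b /andP[_]; rewrite eq_sym => /negbTE ->.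
  rewrite -!big_split/=; apply: eq_bigr => b bi.
  by rewrite /Qcert !yE//; case: eqP => [<-|_]; ring.
move=> v.
have vE (F : 'I_d -> R) : \sum_a v a * F a = \sum_(a | lab a == i) (u a - U / N) * F a.
  rewrite [RHS]big_mkcond; apply: eq_bigr => a _; rewrite /v.
  by case: ifP => // _; rewrite mul0r.
have v2 : \sum_a v a ^+ 2 = \sum_(a | lab a == i) u a ^+ 2 - U ^+ 2 / N.
  rewrite vE; transitivity (\sum_(a | lab a == i) (u a ^+ 2 - u a * (2 * (U / N)) + (U / N) ^+ 2)).
    by apply: eq_bigr => a ai; rewrite /v ai; ring.
  rewrite big_split sumrB -mulr_suml sum_cluster_const -/U -/N/=; field; exact: N0.
have vDv : \sum_a \sum_b v a * D a b * v b = Duu - 2 * (U / N) * ru + (U / N) ^+ 2 * tot.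
  have -> : \sum_a \sum_b v a * D a b * v b =
      \sum_(a | lab a == i) \sum_(b | lab b == i) (u a - U / N) * D a b * (u b - U / N).
    transitivity (\sum_a v a * \sum_b v b * D a b).
      apply: eq_bigr => a _; rewrite mulr_sumr; apply: eq_bigr => b _; ring.
    rewrite vE; apply: eq_bigr => a _; rewrite vE mulr_sumr.
    by apply: eq_bigr => b _; ring.
  have ruE : ru = \sum_(a | lab a == i) \sum_(b | lab b == i) D a b * u b.
    rewrite exchange_big; apply: eq_bigr => a _; rewrite /row mulr_sumr.
    by apply: eq_bigr => b _; rewrite mulrC symD.
  rewrite [2 * _ * ru](_ : _ = (U / N) * ru + (U / N) * ru); last by ring.
  rewrite {2}ruE /ru /Duu /tot opprD !mulr_sumr -!sumrN -!big_split/=.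
  apply: eq_bigr => a _; rewrite /row !mulr_sumr -!sumrN -!big_split/=.
  by apply: eq_bigr => b _; ring.
rewrite LE uyE v2 vDv; field; exact: N0.
Qed.

Section sample.
Variables (n : nat) (X : 'M[R]_(n, d)) (G : 'I_d -> R).

Let D : 'M[R]_d := diag_mx (\row_j G j) - Sigmahat X.

Lemma diag_sub_SigmahatE a b :
  D a b = (if a == b then G a else 0) - n%:R^-1 * \sum_l X l a * X l b.
Proof. by rewrite !mxE; case: eqP; rewrite ?mulr1n ?mulr0n. Qed.

Lemma diag_sub_Sigmahat_sym a b : D a b = D b a.
Proof.
rewrite !diag_sub_SigmahatE eq_sym; congr (_ - _ * _).
  by case: eqP => // ->.
by apply: eq_bigr => l _; rewrite mulrC.
Qed.

Lemma diag_sub_Sigmahat_form (v : 'I_d -> R) :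
  \sum_a \sum_b v a * D a b * v b =
  \sum_a G a * v a ^+ 2 - n%:R^-1 * \sum_l (\sum_a v a * X l a) ^+ 2.
Proof.
transitivity (\sum_a (G a * v a ^+ 2 - \sum_b n%:R^-1 * \sum_l (v a * X l a) * (v b * X l b))).
  apply: eq_bigr => a _.
  rewrite (_ : G a * v a ^+ 2 = \sum_b (if a == b then G a * v a * v b else 0)).
    rewrite -sumrB; apply: eq_bigr => b _; rewrite diag_sub_SigmahatE.
    have -> : \sum_l (v a * X l a) * (v b * X l b) = v a * v b * \sum_l X l a * X l b.
      by rewrite mulr_sumr; apply: eq_bigr => l _; ring.
    by case: eqP => [<-|_]; ring.
  rewrite (bigD1 a)//= eqxx big1 ?addr0; first by ring.
  by move=> b; rewrite eq_sym => /negbTE ->.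
rewrite sumrB; congr (_ - _).
under eq_bigr do rewrite -mulr_sumr exchange_big.
rewrite -mulr_sumr exchange_big; congr (_ * _); apply: eq_bigr => l _.
rewrite expr2 mulr_suml; apply: eq_bigr => a _.
by rewrite mulr_sumr.
Qed.

Let xs k l := \sum_(c | lab c == k) X l c.

Definition cluster_mean_coef (a c : 'I_d) : R :=
  (c == a)%:R - (if lab c == lab a then (clsize lab (lab a))%:R^-1 else 0).

Lemma sum_cluster_mean_coef (F : 'I_d -> R) a :
  \sum_c cluster_mean_coef a c * F c =
  F a - (\sum_(c | lab c == lab a) F c) / (clsize lab (lab a))%:R.
Proof.
under eq_bigr do rewrite mulrBl; rewrite sumrB; congr (_ - _).
  rewrite (bigD1 a)//= eqxx mul1r big1 ?addr0// => c /negbTE ->.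
  by rewrite mul0r.
rewrite mulr_suml [RHS]big_mkcond; apply: eq_bigr => c _.
by case: ifP => _; rewrite ?mul0r// mulrC.
Qed.

(** Per sample, - x y = ((x - y) ^ 2 - x ^ 2 - y ^ 2) / 2, and x t - t ^ 2 / 2 = (x ^ 2 - (x - t) ^
    2) / 2 with t the cluster mean of x. The squares of the raw coordinates cancel, leaving three
    squared linear forms to which the deviation estimate applies. *)
Lemma ypcert_squares (yT : R) (a b : 'I_d) :
  (forall k, (0 < clsize lab k)%N) -> lab a != lab b ->
  let N c : R := (clsize lab (lab c))%:R in
  let q (v : 'I_d -> R) := n%:R^-1 * \sum_l (\sum_c v c * X l c) ^+ 2 in
  let gam c := (\sum_(e | lab e == lab c) G e) / (2 * N c ^+ 2) - G c / N c in
  ypcert lab D yT a b =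
    (q (fun c => (c == a)%:R - (c == b)%:R) - q (cluster_mean_coef a)
       - q (cluster_mean_coef b)) / 2
    + gam a + gam b - yT / (2 * N a) - yT / (2 * N b).
Proof.
move=> cl0 ab N q gam.
have N0 c : N c != 0 by rewrite pnatr_eq0 -lt0n.
have rowE c k : lab c = k -> \sum_(e | lab e == k) D c e =
    G c - n%:R^-1 * \sum_l X l c * xs k l.
  move=> ck; under eq_bigr do rewrite diag_sub_SigmahatE.
  rewrite sumrB; congr (_ - _).
    rewrite (bigD1 c) ?ck//= eqxx big1 ?addr0//.
    by move=> e /andP[_]; rewrite eq_sym => /negbTE ->.
  rewrite -mulr_sumr exchange_big/=; congr (_ * _); apply: eq_bigr => l _.
  by rewrite mulr_sumr.
have totE k : \sum_(c | lab c == k) \sum_(e | lab e == k) D c e =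
    \sum_(c | lab c == k) G c - n%:R^-1 * \sum_l xs k l ^+ 2.
  transitivity (\sum_(c | lab c == k) (G c - n%:R^-1 * \sum_l X l c * xs k l)).
    by apply: eq_bigr => c /eqP ck; exact: rowE.
  rewrite sumrB; congr (_ - _).
  rewrite -mulr_sumr exchange_big/=; congr (_ * _); apply: eq_bigr => l _.
  by rewrite -mulr_suml expr2.
have yE c : ycert lab D yT c = gam c - yT / (2 * N c) +
    n%:R^-1 * \sum_l (X l c * xs (lab c) l / N c - xs (lab c) l ^+ 2 / (2 * N c ^+ 2)).
  rewrite /ycert rowE// totE sumrB -!mulr_suml /gam -/(N c); ring.
have neq : (a == b) = false by apply: contraNF ab => /eqP ->.
rewrite /ypcert !yE diag_sub_SigmahatE neq sub0r.
suff : - (n%:R^-1 * \sum_l X l a * X l b)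
  + n%:R^-1 * \sum_l (X l a * xs (lab a) l / N a - xs (lab a) l ^+ 2 / (2 * N a ^+ 2))
  + n%:R^-1 * \sum_l (X l b * xs (lab b) l / N b - xs (lab b) l ^+ 2 / (2 * N b ^+ 2))
  = (q (fun c => (c == a)%:R - (c == b)%:R) - q (cluster_mean_coef a)
       - q (cluster_mean_coef b)) / 2 by move=> <-; ring.
rewrite /q -!mulrN -!mulrDr -mulrA; congr (_ * _).
rewrite -!sumrN -!big_split/= mulr_suml; apply: eq_bigr => l _.
rewrite !sum_cluster_mean_coef -/(N a) -/(N b) -/(xs _ l) -/(xs _ l).
rewrite (sum_diff_coef (X l)).
by field; rewrite !N0.
Qed.

End sample.
End certificate_algebra.

(** * The Gaussian latent model *)

Section model.
Context {R : realType} (n d K : nat) (lab : 'I_d -> 'I_K) (L : 'M[R]_K).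
Variables (gamma : 'I_d -> R) (dT : measure_display) (T : measurableType dT).
Variables (xi : 'I_n -> 'I_(K + d) -> T -> R).
Hypothesis gamma0 : forall j, 0 <= gamma j.

Let C := L *m L^T.
Let X := Xdata lab L gamma xi.

(** Coordinates, in the i.i.d. normals [xi l i], of the linear form in the data with coefficients
    [v]; their squared norm is its variance. *)
Definition data_coef (v : 'I_d -> R) (i : 'I_(K + d)) : R :=
  match fintype.split i with
  | inl r => \sum_a v a * L (lab a) r
  | inr j => v j * Num.sqrt (gamma j)
  end.

Definition noise_coef (v : 'I_d -> R) (i : 'I_(K + d)) : R :=
  match fintype.split i with
  | inl r => 0
  | inr j => v j * Num.sqrt (gamma j)
  end.

Definition noise (w : T) : 'M[R]_(n, d) :=
  \matrix_(l < n, j < d) (Num.sqrt (gamma j) * xi l (rshift K j) w).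

Let splitl r : fintype.split (lshift d r : 'I_(K + d)) = inl r.
Proof. exact: (unsplitK (inl r)). Qed.

Let splitr j : fintype.split (rshift K j : 'I_(K + d)) = inr j.
Proof. exact: (unsplitK (inr j)). Qed.

Lemma data_coef_lin v l w :
  \sum_i data_coef v i * xi l i w = \sum_a v a * X w l a.
Proof.
rewrite big_split_ord/= /data_coef.
under eq_bigr do rewrite splitl; under [X in _ + X]eq_bigr do rewrite splitr.
under [RHS]eq_bigr do rewrite mxE mulrDr.
rewrite big_split/=; congr (_ + _); last first.
  by apply: eq_bigr => a _; rewrite mulrA.
under eq_bigr do rewrite mulr_suml; rewrite exchange_big/=.
apply: eq_bigr => a _; rewrite /Zlat mulr_sumr.
by apply: eq_bigr => r _; rewrite mulrA.
Qed.

Lemma noise_coef_lin v l w :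
  \sum_i noise_coef v i * xi l i w = \sum_a v a * noise w l a.
Proof.
rewrite big_split_ord/= /noise_coef.
under eq_bigr do rewrite splitl mul0r; rewrite big1_eq add0r.
by apply: eq_bigr => a _; rewrite splitr mxE mulrA.
Qed.

Lemma data_coef_var v : \sum_i data_coef v i ^+ 2 =
  \sum_r (\sum_a v a * L (lab a) r) ^+ 2 + \sum_a gamma a * v a ^+ 2.
Proof.
rewrite big_split_ord/= /data_coef.
under eq_bigr do rewrite splitl; congr (_ + _).
by apply: eq_bigr => a _; rewrite splitr exprMn sqr_sqrtr// mulrC.
Qed.

Lemma noise_coef_var v : \sum_i noise_coef v i ^+ 2 = \sum_a gamma a * v a ^+ 2.
Proof.
rewrite big_split_ord/= /noise_coef.
under eq_bigr do rewrite splitl expr0n/=; rewrite big1_eq add0r.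
by apply: eq_bigr => a _; rewrite splitr exprMn sqr_sqrtr// mulrC.
Qed.

Lemma data_lin_noise v l w : (forall r, \sum_a v a * L (lab a) r = 0) ->
  \sum_a v a * X w l a = \sum_a v a * noise w l a.
Proof.
move=> v0; rewrite -data_coef_lin -noise_coef_lin; apply: eq_bigr => i _.
rewrite /data_coef /noise_coef; case: (fintype.split i) => // r.
by rewrite v0.
Qed.

Let CE j k : C j k = \sum_r L j r * L k r.
Proof. by rewrite mxE; apply: eq_bigr => r _; rewrite mxE. Qed.

Lemma diff_var a b : a != b ->
  \sum_i data_coef (fun c => (c == a)%:R - (c == b)%:R) i ^+ 2 =
  C (lab a) (lab a) + C (lab b) (lab b) - 2 * C (lab a) (lab b)
    + gamma a + gamma b.
Proof.
move=> ab; rewrite data_coef_var -addrA; congr (_ + _).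
  under eq_bigr do rewrite (sum_diff_coef (fun c => L (lab c) _)).
  rewrite !CE mulr_sumr -sumrN -!big_split/=; apply: eq_bigr => r _; ring.
transitivity (\sum_c ((c == a)%:R - (c == b)%:R) * (gamma c * ((c == a)%:R - (c == b)%:R))).
  by apply: eq_bigr => c _; ring.
by rewrite sum_diff_coef !eqxx (eq_sym b a) (negbTE ab)/=; ring.
Qed.

(** The latent part vanishes because the coefficients are supported on the cluster of [a] and sum to
    zero there. Subtracting half of this value for [a] and for [b] from half of [diff_var] leaves
    half the separation plus terms in [gamma] that cancel [gam a + gam b] when [G = gamma]. *)
Lemma mean_var a : (0 < clsize lab (lab a))%N ->
  let N : R := (clsize lab (lab a))%:R in
  \sum_i data_coef (cluster_mean_coef lab a) i ^+ 2 =
  gamma a - 2 * gamma a / N + (\sum_(c | lab c == lab a) gamma c) / N ^+ 2.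
Proof.
move=> cl0 N; have N0 : N != 0 by rewrite pnatr_eq0 -lt0n.
rewrite data_coef_var big1 ?add0r; last first.
  move=> r _; rewrite sum_cluster_mean_coef.
  rewrite (eq_bigr (fun=> L (lab a) r)); last by move=> c /eqP ->.
  by rewrite sum_cluster_const mulfK// subrr expr0n.
transitivity (\sum_c cluster_mean_coef lab a c * (gamma c * cluster_mean_coef lab a c)).
  by apply: eq_bigr => c _; ring.
rewrite sum_cluster_mean_coef -/N.
rewrite (eq_bigr (fun c => gamma c * cluster_mean_coef lab a c))//.
have -> : \sum_(c | lab c == lab a) gamma c * cluster_mean_coef lab a c =
    gamma a - (\sum_(c | lab c == lab a) gamma c) / N.
  rewrite mulr_suml (bigD1 a)//= [in RHS](bigD1 a)//= opprD addrA; congr (_ + _).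
    by rewrite /cluster_mean_coef !eqxx -/N/=; ring.
  rewrite -sumrN; apply: eq_bigr => c /andP[ca /negbTE neq].
  by rewrite /cluster_mean_coef ca neq -/N/=; ring.
by rewrite /cluster_mean_coef !eqxx -/N/=; field.
Qed.

(** * Deterministic consequences of the good event *)

Section good_event.
Variables (w : T) (G : 'I_d -> R) (g e : R).
Hypotheses (n0 : (0 < n)%N) (cl3 : forall k, (3 <= clsize lab k)%N).
Hypothesis gamma_le : forall j, gamma j <= g.
Hypothesis G_le : forall j, `|G j - gamma j| <= e.

Let nR : 0 < n%:R :> R. Proof. by rewrite ltr0n. Qed.

Let cl0 k : (0 < clsize lab k)%N.
Proof. exact: leq_trans (cl3 k). Qed.

Let D : 'M[R]_d := diag_mx (\row_j G j) - Sigmahat (X w).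

Local Notation dev x := (12 * Num.sqrt (n%:R * x) + 48 * x).

Lemma Q_psd_of_net (x yT : R) (i : 'I_K) : 0 <= x -> 0 <= g ->
  (forall phi, phi \in net d ->
     ~ quadratic_deviation xi (noise_coef (net_point phi)) x w) ->
  2 * (g * (dev x / n%:R)) + e <= yT ->
  Q_psd lab D yT i.
Proof.
move=> x0 g0 good yT_ge u.
have dev0 : 0 <= dev x by rewrite addr_ge0 ?mulr_ge0.
rewrite Qcert_form//; last exact: diag_sub_Sigmahat_sym.
pose v a := if lab a == i
  then u a - (\sum_(c | lab c == i) u c) / (clsize lab i)%:R else 0.
change (0 <= \sum_a \sum_b v a * D a b * v b + yT * \sum_a v a ^+ 2).
rewrite diag_sub_Sigmahat_form.
have v0 r : \sum_a v a * L (lab a) r = 0.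
  transitivity (\sum_(a | lab a == i)
      (u a - (\sum_(c | lab c == i) u c) / (clsize lab i)%:R) * L i r).
    rewrite [RHS]big_mkcond; apply: eq_bigr => a _; rewrite /v.
    by case: eqP => [->//|_]; rewrite mul0r.
  rewrite -mulr_suml sumrB sum_cluster_const divfK ?subrr ?mul0r//.
  by rewrite pnatr_eq0 -lt0n.
under [X in _^-1 * X]eq_bigr do rewrite (data_lin_noise _ _ v0).
(* Net points are not centred on clusters, so the net is applied to the pure noise form; the form of
   [D] differs from it at the centred [v] only by the error of [G]. *)
pose M : 'M[R]_d := diag_mx (\row_j gamma j) - Sigmahat (noise w).
have bilE z : bilin M z z =
    \sum_a gamma a * z a ^+ 2 - n%:R^-1 * \sum_l (\sum_a z a * noise w l a) ^+ 2.
  exact: diag_sub_Sigmahat_form.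
have netB phi : phi \in net d ->
    `|bilin M (net_point phi) (net_point phi)| <=
    g * (dev x / n%:R) * \sum_a net_point phi a ^+ 2 :> R.
  move=> /good; rewrite /quadratic_deviation/= => /negP; rewrite -leNgt.
  under eq_bigr do rewrite noise_coef_lin.
  rewrite noise_coef_var; set z := net_point phi => h.
  rewrite bilE -normrN opprB.
  rewrite (_ : _ - _ = n%:R^-1 * (\sum_l (\sum_a z a * noise w l a) ^+ 2
     - n%:R * \sum_a gamma a * z a ^+ 2)); last by field; rewrite gt_eqF.
  rewrite normrM ger0_norm ?invr_ge0//.
  rewrite [leLHS]mulrC ler_pdivrMr//.
  apply: le_trans h _.
  rewrite (_ : _ * n%:R = g * (\sum_a z a ^+ 2) * dev x); last first.
    by field; rewrite gt_eqF.
  apply: ler_wpM2r => //; rewrite mulr_sumr; apply: ler_sum => a _.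
  by apply: ler_wpM2r; first exact: sqr_ge0.
have := net_quadratic_form_le (diag_sub_Sigmahat_sym (noise w) gamma)
  (mulr_ge0 g0 (divr_ge0 dev0 (ltW nR))) netB v.
rewrite bilE ler_norml => /andP[h _].
have hG : \sum_a gamma a * v a ^+ 2 - e * \sum_a v a ^+ 2 <= \sum_a G a * v a ^+ 2.
  rewrite mulr_sumr -sumrB; apply: ler_sum => a _; rewrite -mulrBl.
  apply: ler_wpM2r; first exact: sqr_ge0.
  by have := G_le a; rewrite ler_norml => /andP[+ _]; lra.
have v2 : 0 <= \sum_a v a ^+ 2 by apply: sumr_ge0 => a _; exact: sqr_ge0.
have := ler_wpM2r v2 yT_ge; lra.
Qed.

Lemma ypcert_of_deviation (x yT s m : R) (a b : 'I_d) : 0 <= x -> 0 <= g ->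
  0 <= yT -> 0 <= e -> lab a != lab b -> 0 < m ->
  (forall c, m <= (clsize lab (lab c))%:R) ->
  (forall k, C k k <= s) ->
  ~ quadratic_deviation xi (data_coef (fun c => (c == a)%:R - (c == b)%:R)) x w ->
  ~ quadratic_deviation xi (data_coef (cluster_mean_coef lab a)) x w ->
  ~ quadratic_deviation xi (data_coef (cluster_mean_coef lab b)) x w ->
  4 * (s + g) * (dev x / n%:R) + e + yT / m <=
    (C (lab a) (lab a) + C (lab b) (lab b) - 2 * C (lab a) (lab b)) / 2 ->
  0 <= ypcert lab D yT a b.
Proof.
move=> x0 g0 yT0 e0 ab m0 m_le C_le.
have dev0 : 0 <= dev x by rewrite addr_ge0 ?mulr_ge0.
have k0 : 0 <= dev x / n%:R by rewrite divr_ge0.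
have devE v : ~ quadratic_deviation xi (data_coef v) x w ->
    `|n%:R^-1 * \sum_l (\sum_c v c * X w l c) ^+ 2 - \sum_i data_coef v i ^+ 2|
    <= (\sum_i data_coef v i ^+ 2) * (dev x / n%:R).
  rewrite /quadratic_deviation/= => /negP; rewrite -leNgt.
  under eq_bigr do rewrite data_coef_lin.
  set S := \sum_l _; set t := \sum_i _ => h.
  rewrite (_ : _ - _ = n%:R^-1 * (S - n%:R * t)); last by field; rewrite gt_eqF.
  by rewrite normrM ger0_norm ?invr_ge0// [leLHS]mulrC ler_pdivrMr// -mulrA divfK// gt_eqF.
have abN : a != b by apply: contraNN ab => /eqP ->.
move=> /devE + /devE + /devE; rewrite diff_var// !mean_var//.
rewrite ypcert_squares//.
set qU := n%:R^-1 * _; set qa := n%:R^-1 * _; set qb := n%:R^-1 * _.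
set Dl := C _ _ + _ - _.
have N3 c : 3 <= (clsize lab (lab c))%:R :> R by rewrite ler_nat.
pose N c : R := (clsize lab (lab c))%:R.
pose S c : R := (\sum_(f | lab f == lab c) gamma f) / N c ^+ 2.
have Npos c : 0 < N c by apply: lt_le_trans (N3 c).
have Nneq c : N c != 0 by rewrite gt_eqF.
have e_div (r c : R) : 0 < r -> r <= c -> e / c <= e / r.
  by move=> r0 rc; rewrite ler_wpM2l// lef_pV2// posrE (lt_le_trans r0).
have Sbound c : 0 <= S c <= g.
  have N1 : 1 <= N c by apply: le_trans (N3 c); rewrite ler1n.
  rewrite divr_ge0 ?sumr_ge0 ?sqr_ge0//= ler_pdivrMr ?exprn_gt0//.
  apply: (@le_trans _ _ (g * N c)).
    by rewrite -sum_cluster_const; apply: ler_sum.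
  by rewrite ler_wpM2l// expr2 ler_peMl.
(* Clusters of size at least 3 give the error e / 6 here and e / 3 for [G c / N c]; over the two
   points [a] and [b] these add up to [e]. *)
have SG c : `|(\sum_(f | lab f == lab c) G f) / (2 * N c ^+ 2) - S c / 2| <= e / 6.
  rewrite (_ : _ - _ = (\sum_(f | lab f == lab c) (G f - gamma f)) / (2 * N c ^+ 2)); last first.
    rewrite sumrB /S; field; exact: Nneq.
  rewrite normrM [`|_^-1|]ger0_norm ?invr_ge0 ?mulr_ge0 ?sqr_ge0//.
  apply: (@le_trans _ _ (e * N c / (2 * N c ^+ 2))).
    rewrite ler_wpM2r ?invr_ge0 ?mulr_ge0 ?sqr_ge0//.
    apply: le_trans (ler_norm_sum _ _ _) _.
    by rewrite -sum_cluster_const; apply: ler_sum.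
  rewrite (_ : _ / _ = e / (2 * N c)); last by field; exact: Nneq.
  by apply: e_div => //; have := N3 c; rewrite -/(N c); lra.
have G3 c : `|G c / N c - gamma c / N c| <= e / 3.
  rewrite -mulrBl normrM [`|_^-1|]ger0_norm ?invr_ge0//.
  apply: le_trans (e_div _ _ _ (N3 c)); last by [].
  by rewrite ler_wpM2r ?invr_ge0.
have yN c : yT / (2 * N c) <= yT / m / 2.
  rewrite -mulrA -invfM ler_wpM2l// lef_pV2 ?posrE ?mulr_gt0//.
  by rewrite mulrC ler_pM2l// m_le.
have gN c : 0 <= gamma c / N c by rewrite divr_ge0.
have Cge0 k : 0 <= C k k by rewrite CE; apply: sumr_ge0 => r _; exact: sqr_ge0.
have s0 : 0 <= s by apply: le_trans (Cge0 (lab a)) (C_le _).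
have Dl_le : Dl <= 4 * s.
  (* This is E (Z_j + Z_k) ^ 2 >= 0, which bounds - 2 C_jk by C_jj + C_kk. *)
  suff : 0 <= C (lab a) (lab a) + C (lab b) (lab b) + 2 * C (lab a) (lab b).
    by have := C_le (lab a); have := C_le (lab b); rewrite /Dl; lra.
  rewrite !CE mulr_sumr -!big_split/=; apply: sumr_ge0 => r _.
  by have := sqr_ge0 (L (lab a) r + L (lab b) r); rewrite sqrrD; lra.
rewrite -/(N a) -/(N b) -/(S a) -/(S b).
rewrite -(mulrA 2 (gamma a)) -(mulrA 2 (gamma b)).
have := Sbound a; have := Sbound b; have := SG a; have := SG b.
have := G3 a; have := G3 b; have := yN a; have := yN b.
have := gN a; have := gN b; have := gamma_le a; have := gamma_le b.
move: (gamma0 a) (gamma0 b).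
set k := dev x / n%:R in k0 *.
move: (gamma a / N a) (gamma b / N b) (G a / N a) (G b / N b) (S a) (S b).
move: (yT / (2 * N a)) (yT / (2 * N b)) (yT / m).
move: (_ / (2 * N a ^+ 2)) (_ / (2 * N b ^+ 2)).
move: Dl Dl_le qU qa qb (gamma a) (gamma b) => D' D'_le qU qa qb ga gb.
move=> SGa SGb ya yb ym gNa gNb Ga' Gb' Sa Sb.
rewrite !ler_norml => ga0 gb0 gb_le ga_le gNb0 gNa0 yb_le ya_le.
move=> /andP[G1 G2] /andP[G4 G5] /andP[H1 H2] /andP[H4 H5] /andP[S1 S2] /andP[S4 S5].
move=> /andP[b1 b2] /andP[a1 a2] /andP[u1 u2] fin.
(* The three variances are at most 4 s + 2 g, 2 g and 2 g; half their sum is 2 s + 3 g, within the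
   allowance 4 (s + g). *)
have hU : (D' + ga + gb) * k <= (4 * s + 2 * g) * k by apply: ler_wpM2r => //; lra.
have ha : (ga - 2 * gNa + Sa) * k <= 2 * g * k by apply: ler_wpM2r => //; lra.
have hb : (gb - 2 * gNb + Sb) * k <= 2 * g * k by apply: ler_wpM2r => //; lra.
have gk : 0 <= g * k by rewrite mulr_ge0.
have sk : 0 <= s * k by rewrite mulr_ge0.
lra.
Qed.

End good_event.
End model.

(** * Rates *)

Section rates.
Context {R : realType}.

(** With r = sqrt (t / n) <= sqrt p0, the linear term t / n = r ^ 2 is absorbed as sqrt p0 times r;
    this is where log d <= p0 n enters the rate. *)
Lemma log_deviation_rate (p0 n t : R) : 0 < n -> 0 <= t -> t <= p0 * n ->
  (12 * Num.sqrt (n * (3 * t)) + 48 * (3 * t)) / n <=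
  (24 + 144 * Num.sqrt p0) * Num.sqrt (t / n).
Proof.
move=> n0 t0 tp; set r := Num.sqrt (t / n).
have r0 : 0 <= r by exact: sqrtr_ge0.
have tE : t = n * r ^+ 2.
  by rewrite sqr_sqrtr ?divr_ge0 ?(ltW n0)// mulrCA divff ?mulr1// gt_eqF.
have rp : r <= Num.sqrt p0 by rewrite ler_wsqrtr// ler_pdivrMr.
have sq : Num.sqrt (n * (3 * t)) <= 2 * (n * r).
  rewrite -(@ger0_norm _ (2 * (n * r))) ?mulr_ge0 ?(ltW n0)//.
  rewrite -sqrtr_sqr ler_wsqrtr// tE.
  have : 0 <= n ^+ 2 * r ^+ 2 by rewrite mulr_ge0 ?sqr_ge0.
  by rewrite !exprMn; lra.
have rr : r ^+ 2 <= Num.sqrt p0 * r by rewrite expr2 ler_wpM2r.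
rewrite ler_pdivrMr//.
have : n * r ^+ 2 <= n * (Num.sqrt p0 * r) by rewrite ler_wpM2l// ltW.
rewrite [in X in _ + X](_ : t = n * r ^+ 2)//; lra.
Qed.

(** Here the linear term is kept, since d / n need not be bounded. The constants are 72 = 12 * 6,
    from sqrt 28 <= 6, and 1344 = 48 * 28. *)
Lemma net_deviation_rate (n D : R) : 0 < n -> 0 <= D ->
  (12 * Num.sqrt (n * (28 * D)) + 48 * (28 * D)) / n <=
  72 * Num.sqrt (D / n) + 1344 * (D / n).
Proof.
move=> n0 D0; set r := Num.sqrt (D / n).
have r0 : 0 <= r by exact: sqrtr_ge0.
have DE : D = n * r ^+ 2.
  by rewrite sqr_sqrtr ?divr_ge0 ?(ltW n0)// mulrCA divff ?mulr1// gt_eqF.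
have sq : Num.sqrt (n * (28 * D)) <= 6 * (n * r).
  rewrite -(@ger0_norm _ (6 * (n * r))) ?mulr_ge0 ?(ltW n0)//.
  rewrite -sqrtr_sqr ler_wsqrtr// DE.
  have : 0 <= n ^+ 2 * r ^+ 2 by rewrite mulr_ge0 ?sqr_ge0.
  by rewrite !exprMn; lra.
rewrite mulrDl; apply: lerD.
  by rewrite ler_pdivrMr//; lra.
by rewrite mulrA -(mulrA _ D); lra.
Qed.

(** Since log d <= d, the error of the estimator is absorbed by sqrt (d / n). The factor 2688 is 2 *
    1344. *)
Lemma yT_rate (p1 g n D t m : R) : 0 < n -> 0 <= g -> 0 <= p1 -> 0 <= D ->
  t <= D -> 0 < m ->
  (2 * (g * ((12 * Num.sqrt (n * (28 * D)) + 48 * (28 * D)) / n))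
     + p1 * g * Num.sqrt (t / n)) / m <=
  (2688 + p1) * g * (Num.sqrt (D / (n * m ^+ 2)) + D / (n * m)).
Proof.
move=> n0 g0 p10 D0 tD m0.
have tr : Num.sqrt (t / n) <= Num.sqrt (D / n).
  by rewrite ler_wsqrtr// ler_wpM2r// invr_ge0 ltW.
have -> : Num.sqrt (D / (n * m ^+ 2)) = Num.sqrt (D / n) / m.
  rewrite invfM mulrA sqrtrM ?divr_ge0 ?(ltW n0)//.
  by rewrite -exprVn sqrtr_sqr ger0_norm// invr_ge0 ltW.
have -> : D / (n * m) = D / n / m by rewrite invfM mulrA.
rewrite -mulrDl [leRHS]mulrA ler_wpM2r ?invr_ge0 ?(ltW m0)//.
have h1 := ler_wpM2l g0 (net_deviation_rate n0 D0).
have h2 := ler_wpM2l (mulr_ge0 p10 g0) tr.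
have h3 : 0 <= g * Num.sqrt (D / n) by rewrite mulr_ge0.
have Dn0 : 0 <= D / n by rewrite divr_ge0// ltW.
have h4 : 0 <= p1 * g * (D / n) by rewrite mulr_ge0// mulr_ge0.
have h5 : 0 <= g * (D / n) by rewrite mulr_ge0.
set q := (12 * _ + _) / n in h1 *; lra.
Qed.

(** Each of the three families of deviations fails with probability at most 2 / d; for the net, 2 <=
    exp 1 leaves exp (- d) <= 1 / d. *)
Lemma failure_rate (p2 : R) (d : nat) : (0 < d)%N -> 0 <= p2 ->
  p2 / d%:R ^+ 3 + ((d * d)%N%:R * (2 * expR (- (3 * ln d%:R)))
    + d%:R * (2 * expR (- (3 * ln d%:R)))
    + 2 ^+ (27 * d) * (2 * expR (- (28 * d%:R)))) <= (p2 + 6) / d%:R.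
Proof.
move=> d0 p20; set D : R := d%:R.
have D1 : 1 <= D by rewrite ler1n.
have Dpos : 0 < D by rewrite ltr0n.
have Dn0 : D != 0 by rewrite gt_eqF.
have e3 : expR (- (3 * ln D)) = (D ^+ 3)^-1.
  by rewrite expRN expRM_natl lnK// posrE.
have D2 : D <= D ^+ 3 by rewrite -[leLHS]expr1 ler_weXn2l.
have D3 : D ^+ 2 <= D ^+ 3 by rewrite ler_weXn2l.
have h1 : p2 / D ^+ 3 <= p2 / D.
  by rewrite ler_wpM2l// lef_pV2// posrE ?exprn_gt0.
have h2 : (d * d)%N%:R * (2 * (D ^+ 3)^-1) = 2 / D.
  by rewrite natrM -/D; field.
have h3 : D * (2 * (D ^+ 3)^-1) <= 2 / D.
  rewrite [leLHS](_ : _ = 2 * (D ^+ 2)^-1); last by field.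
  by rewrite ler_wpM2l// lef_pV2 ?posrE ?exprn_gt0// -[leLHS]expr1 ler_weXn2l.
have h4 : 2 ^+ (27 * d) * (2 * expR (- (28 * D))) <= 2 / D.
  have -> : expR (- (28 * D)) = expR (- D) * expR (- ((27 * d)%N%:R * 1)).
    by rewrite -expRD natrM -/D; congr expR; ring.
  have le1 : 2 ^+ (27 * d) * expR (- ((27 * d)%N%:R * 1)) <= 1 :> R.
    rewrite expRN expRM_natl -/D ler_pdivrMr ?exprn_gt0 ?expR_gt0// mul1r.
    by rewrite lerXn2r ?nnegrE ?expR_ge0//; have := @expR_ge1Dx R 1; lra.
  have le2 : expR (- D) <= D^-1.
    rewrite expRN lef_pV2 ?posrE ?expR_gt0//.
    by apply: le_trans (expR_ge1Dx _); rewrite lerDr.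
  rewrite mulrCA [_ * (expR _ * _)]mulrCA ler_wpM2l//.
  by apply: le_trans le2; rewrite ler_piMr ?expR_ge0.
rewrite e3 h2 [leRHS]mulrDl.
have -> : 6 / D = 2 / D + 2 / D + 2 / D by field.
by lra.
Qed.

(** Only half of the separation survives in y', hence the doubled constants. The estimator error p1
    g rho is charged to the sigma term, as g <= s + g. *)
Lemma separation_budget (kappa p1 g s rho dv yTm r1 r2 r3 D : R) :
  0 <= p1 -> 0 <= g -> 0 <= s -> 0 <= rho -> 0 <= r1 ->
  dv <= kappa * rho -> yTm <= (2688 + p1) * g * (r2 + r3) ->
  2 * (2688 + p1) * g * (r1 + r2 + r3) + 2 * (4 * kappa + p1) * (s + g) * rho <= D ->
  4 * (s + g) * dv + p1 * g * rho + yTm <= D / 2.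
Proof.
move=> p10 g0 s0 rho0 r10 dv_le yT_le D_ge.
have h1 := ler_wpM2l (addr_ge0 s0 g0) dv_le.
have h2 : 0 <= p1 * s * rho by rewrite mulr_ge0// mulr_ge0.
have h3 : 0 <= g * r1 by rewrite mulr_ge0.
have h4 : 0 <= p1 * (g * r1) by rewrite mulr_ge0.
lra.
Qed.

Lemma ln_natr_le (d : nat) : (0 < d)%N -> ln d%:R <= d%:R :> R.
Proof.
move=> d0; have d1 : 1 <= d%:R :> R by rewrite ler1n.
have -> : d%:R = 1 + (d%:R - 1) :> R by ring.
by apply: le_trans (le_ln1Dx _) _; lra.
Qed.

Lemma minclsize_le (d K : nat) (lab : 'I_d -> 'I_K) k :
  (minclsize lab <= clsize lab k)%N.
Proof.
rewrite /minclsize; have := mem_index_enum k.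
elim: index_enum => // j s IH; rewrite inE big_cons geq_min.
by case/predU1P => [->|/IH ->]; rewrite ?leqnn ?orbT.
Qed.

Lemma clsize_le (d K : nat) (lab : 'I_d -> 'I_K) k : (clsize lab k <= d)%N.
Proof. by rewrite -[leqRHS](card_ord d) /clsize max_card. Qed.

End rates.

(** * Probability of the good event and choice of constants *)

Theorem theorem4p1 (R : realType) (p0 p1 p2 : R) :
  0 < p0 -> 0 < p1 -> 0 < p2 ->
  exists c1 c2 c3 : R, 0 < c1 /\ 0 < c2 /\ 0 < c3 /\
  forall (n d K : nat) (lab : 'I_d -> 'I_K) (L : 'M[R]_K) (gamma : 'I_d -> R)
    (dT : measure_display) (T : measurableType dT) (P : probability T R)
    (xi : 'I_n -> 'I_(K + d) -> T -> R)
    (Ghat : 'M[R]_(n, d) -> 'I_d -> R),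
    (* G* is a partition of [d] into K clusters, each of size >= 3 *)
    (forall k : 'I_K, (3 <= clsize lab k)%N) ->
    (* Gamma* diagonal covariance *)
    (forall j, 0 <= gamma j) ->
    (* xi^l_r i.i.d. standard normal *)
    (forall l r, std_normal_rv P (xi l r)) ->
    mutually_independent P (fun lr : 'I_n * 'I_(K + d) => xi lr.1 lr.2) ->
    let C := L *m L^T in
    let m := minclsize lab in
    let g := gmax gamma in
    let sigma := \big[Num.max/0]_(k : 'I_K) C k k + g in
    let X := Xdata lab L gamma xi in
    (* Delta(Cstar) > 0 *)
    (forall j k : 'I_K, (j < k)%N -> 0 < C j j + C k k - 2 * C j k) ->
    (* estimator assumption for Gamma-hat (a function of the data) *)
    (exists B : set T, measurable B /\
       ((1 - p2 / (d%:R ^+ 3))%:E <= P B)%E /\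
       forall w, B w -> forall j,
         `|Ghat (X w) j - gamma j| <= p1 * g * Num.sqrt (ln d%:R / n%:R)) ->
    (* log d <= p0 n *)
    ln d%:R <= p0 * n%:R ->
    (* separation condition on Delta(Cstar) *)
    (forall j k : 'I_K, (j < k)%N ->
       c1 * g * (Num.sqrt (ln d%:R / (n%:R * m%:R))
                 + Num.sqrt (d%:R / (n%:R * m%:R ^+ 2))
                 + d%:R / (n%:R * m%:R))
       + c2 * sigma * Num.sqrt (ln d%:R / n%:R)
       <= C j j + C k k - 2 * C j k) ->
    exists A : set T, measurable A /\
      ((1 - c3 / d%:R)%:E <= P A)%E /\
      forall w, A w ->
        certificate_exists lab (diag_mx (\row_j Ghat (X w) j) - Sigmahat (X w)).
Proof.
move=> p0_gt0 p1_gt0 p2_gt0.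
pose kappa : R := 24 + 144 * Num.sqrt p0.
have kappa0 : 0 < kappa by rewrite ltr_pwDl// mulr_ge0.
exists (2 * (2688 + p1)), (2 * (4 * kappa + p1)), (p2 + 6).
split; first lra.
split; first lra.
split; first lra.
move=> n d K lab L gamma dT T P xi Ghat cl3 gamma0 nxi indep C m g sigma X _.
move=> [B [mB [PB GB]]] ln_le sep.
(* For d = 0 division by zero returns 0, so probability 1 is demanded; the certificate is then
   vacuous, since a cluster would need three points. *)
have [d_eq0|d_gt0] := posnP d.
  exists setT; split; first exact: measurableT.
  split; first by rewrite probability_setT d_eq0 invr0 mulr0 subr0.
  move=> w _; exists 0; split => //; split; last first.
    by move=> a; have := ltn_ord a; rewrite {2}d_eq0.
  by move=> i; have := leq_trans (cl3 i) (clsize_le lab i); rewrite {1}d_eq0.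
have d3 : (3 <= d)%N.
  have := clsize_le lab (lab (Ordinal d_gt0)); exact: leq_trans (cl3 _).
have dR : 0 < d%:R :> R by rewrite ltr0n.
have ln0 : 0 < ln d%:R :> R by rewrite ln_gt0// ltr1n ltnW.
(* With n = 0 the assumption would read log d <= 0, which d >= 3 excludes. *)
have n0 : (0 < n)%N.
  rewrite lt0n; apply/negP => /eqP n_eq0.
  by move: ln_le; rewrite n_eq0 mulr0 leNgt ln0.
have nR : 0 < n%:R :> R by rewrite ltr0n.
(* The minimum is taken with default value [d], itself at least 3. *)
have m3 : (3 <= m)%N.
  rewrite /m /minclsize; elim/big_ind : _ => // x y x3 y3.
  by rewrite leq_min x3.
have mR : 0 < m%:R :> R by rewrite ltr0n; apply: leq_trans m3.
have gamma_le j : gamma j <= g.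
  by apply: le_trans (ler_norm _) _; exact: (le_bigmax 0 (fun j => `|gamma j|)).
have g0 : 0 <= g by apply: le_trans (gamma0 (Ordinal d_gt0)) (gamma_le _).
pose s := \big[Num.max/0]_(k : 'I_K) C k k.
have C_le k : C k k <= s by exact: (le_bigmax 0 (fun k => C k k)).
pose rho : R := Num.sqrt (ln d%:R / n%:R).
have rho0 : 0 <= rho by exact: sqrtr_ge0.
pose e := p1 * g * rho.
have e0 : 0 <= e by rewrite mulr_ge0// mulr_ge0// ltW.
pose x1 : R := 3 * ln d%:R; pose x2 : R := 28 * d%:R.
have x10 : 0 <= x1 by rewrite mulr_ge0// ltW.
have x20 : 0 <= x2 by rewrite mulr_ge0.
pose U (ab : 'I_d * 'I_d) := quadratic_deviation xi
  (data_coef lab L gamma (fun c => (c == ab.1)%:R - (c == ab.2)%:R)) x1.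
pose V a := quadratic_deviation xi (data_coef lab L gamma (cluster_mean_coef lab a)) x1.
pose W phi := quadratic_deviation xi (noise_coef (K := K) gamma (net_point phi)) x2.
pose bad := (\big[setU/set0]_ab U ab) `|` (\big[setU/set0]_a V a) `|`
  (\big[setU/set0]_(phi | phi \in net d) W phi).
have mU ab : measurable (U ab) by exact: measurable_quadratic_deviation.
have mV a : measurable (V a) by exact: measurable_quadratic_deviation.
have mW phi : measurable (W phi) by exact: measurable_quadratic_deviation.
have m1 : measurable (\big[setU/set0]_ab U ab) by exact: bigsetU_measurable.
have m2 : measurable (\big[setU/set0]_a V a) by exact: bigsetU_measurable.
have m3' : measurable (\big[setU/set0]_(phi | phi \in net d) W phi).
  exact: bigsetU_measurable.
have mbad : measurable bad by do 2 apply: measurableU => //.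
pose q1 : R := 2 * expR (- x1); pose q2 : R := 2 * expR (- x2).
have Pbad : (P bad <= ((d * d)%N%:R * q1 + d%:R * q1 + 2 ^+ (27 * d) * q2)%:E)%E.
  apply: le_trans (measureU2 _ (measurableU _ _ m1 m2) m3') _.
  rewrite EFinD; apply: leeD.
    apply: le_trans (measureU2 _ m1 m2) _; rewrite EFinD; apply: leeD.
      apply: le_trans (measure_bigsetU_le (p := fun=> q1) xpredT mU _) _.
        by move=> ab; exact: quadratic_deviation_prob.
      by rewrite lee_fin sumr_const card_prod card_ord mulr_natl.
    apply: le_trans (measure_bigsetU_le (p := fun=> q1) xpredT mV _) _.
      by move=> a; exact: quadratic_deviation_prob.
    by rewrite lee_fin sumr_const card_ord mulr_natl.
  apply: le_trans (measure_bigsetU_le (p := fun=> q2) (fun phi => phi \in net d) mW _) _.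
    by move=> phi; exact: quadratic_deviation_prob.
  rewrite lee_fin sumr_const -[leLHS]mulr_natl ler_wpM2r ?mulr_ge0 ?expR_ge0//.
  exact: card_net.
(* [Ghat] is a function of the same data as the deviation events, so the two kinds of failure are
   combined by a union bound. *)
have mA : measurable (B `&` ~` bad) by apply: measurableI => //; exact: measurableC.
exists (B `&` ~` bad); split=> //.
split.
  have PBle : (P B <= P (B `&` ~` bad) + P bad)%E.
    apply: le_trans (measureU2 _ mA mbad).
    apply: le_measure; rewrite ?inE//.
      exact: measurableU.
    by move=> w Bw; have [bw|nbw] := pselect (bad w); [right|left].
  have PA : P (B `&` ~` bad) \is a fin_num by exact: fin_num_measure.
  have := le_trans PB (le_trans PBle (leeD2l _ Pbad)).
  rewrite -(fineK PA) -EFinD !lee_fin.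
  have := failure_rate d_gt0 (ltW p2_gt0).
  by rewrite -/x1 -/x2 -/q1 -/q2; lra.
move=> w [Bw nbad].
have nU a b : ~ U (a, b) w.
  by move=> Uw; apply: nbad; left; left; rewrite (bigD1 (a, b))//=; left.
have nV a : ~ V a w.
  by move=> Vw; apply: nbad; left; right; rewrite (bigD1 a)//=; left.
have nW phi : phi \in net d -> ~ W phi w.
  by move=> hphi Ww; apply: nbad; right; rewrite (bigD1 phi)//=; left.
pose yT := 2 * (g * ((12 * Num.sqrt (n%:R * x2) + 48 * x2) / n%:R)) + e.
have yT0 : 0 <= yT.
  by rewrite addr_ge0// !mulr_ge0// addr_ge0// mulr_ge0.
exists yT; split => //; split.
  by move=> i; apply: (Q_psd_of_net L gamma0 n0 cl3 gamma_le (GB w Bw) i x20 g0 nW).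
move=> a b ab.
apply: (ypcert_of_deviation gamma0 n0 cl3 gamma_le (GB w Bw) (s := s) (m := m%:R)
  x10 g0 yT0 e0 ab mR _ C_le (nU a b) (nV a) (nV b)).
  by move=> c; rewrite ler_nat minclsize_le.
have symC j k : C j k = C k j.
  by rewrite !mxE; apply: eq_bigr => r _; rewrite !mxE mulrC.
have h : 2 * (2688 + p1) * g *
      (Num.sqrt (ln d%:R / (n%:R * m%:R)) + Num.sqrt (d%:R / (n%:R * m%:R ^+ 2))
        + d%:R / (n%:R * m%:R)) + 2 * (4 * kappa + p1) * sigma * rho
    <= C (lab a) (lab a) + C (lab b) (lab b) - 2 * C (lab a) (lab b).
  have [lt_ab|lt_ba|/val_inj eq_ab] := ltngtP (lab a) (lab b).
  - exact: sep.
  - by rewrite (addrC (C (lab a) (lab a))) (symC (lab a)); exact: sep.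
  - by rewrite eq_ab eqxx in ab.
have s0 : 0 <= s.
  by apply: le_trans (C_le (lab a)); rewrite mxE; apply: sumr_ge0 => r _;
    rewrite mxE -expr2 sqr_ge0.
apply: separation_budget h => //; first exact: ltW.
  exact: (log_deviation_rate nR (ltW ln0) ln_le).
exact: (yT_rate nR g0 (ltW p1_gt0) (ltW dR) (ln_natr_le d_gt0) mR).
Qed.
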